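(* Let $f:\bar Y\to Y$ be a morphism in $\mathcal S_X$. Let $L_1$ and $L_2$ be line bundles on $Y$ and let $\bar A:\,f^*L_1\leadsto f^*L_2$ be an alignment on $\bar Y$. Suppose that $[L_1]=[L_2]$ in $\mathrm{Pic}_X(Y)/2$. Then there exists an alignment $A:\,L_1\leadsto L_2$ on $Y$ and an isomorphism of alignments $f^*A\simeq\bar A$ on $\bar Y$.
   Context: All schemes are regular, noetherian, separated over $\mathbb Z[\tfrac12]$ and of finite Krull dimension; $X$ is a fixed such base scheme. Alignments. For line bundles $L_1,L_2$ on a scheme $Y$, an alignment $A:L_1\leadsto L_2$ is a pair $A=(M,\phi)$ where $M$ is a line bundle on $Y$ and $\phi:M^{\otimes 2}\otimes L_1\to L_2$ is an isomorphism. Two alignments $(M,\phi),(M',\phi')$ from $L_1$ to $L_2$ are isomorphic, written $\simeq$, if there is an isomorphism $\tau:M\to M'$ with $\phi=\phi'\circ(\tau^{\otimes 2}\otimes 1)$. For a morphism $f:\bar Y\to Y$ and $A=(M,\phi):L_1\leadsto L_2$ on $Y$, set $f^*A:=(f^*M,f^*\phi):f^*L_1\leadsto f^*L_2$. The category $\mathcal S_X$. For $\pi_Y:Y\to X$ let $\mathrm{Pic}_X(Y)=\mathrm{Pic}(Y)/\pi_Y^*(\mathrm{Pic}(X))$. $\mathcal S_X$ is the full subcategory of smooth $X$-schemes $\pi_Y:Y\to X$ (with $X$-morphisms) such that: (I) $\pi_Y^*:\mathrm{Pic}(X)\to\mathrm{Pic}(Y)$ is injective; (II) $\mathrm{Pic}_X(Y)$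 has no $2$-torsion; (III) $\pi_Y^*:\mathbb G_m(X)\to\mathbb G_m(Y)/\mathbb G_m(Y)^2$ is surjective. Here $\mathbb G_m(Y)=\mathcal O_Y(Y)^\times$. *)

(* Defs.v *)
From HB Require Import structures.
From mathcomp Require Import all_boot all_algebra generic_quotient.
From mathcomp Require Import boolp classical_sets topology_structure.

Set Implicit Arguments.
Unset Strict Implicit.
Unset Printing Implicit Defensive.

Import GRing.Theory.
Local Open Scope ring_scope.
Local Open Scope quotient_scope.

Record opens (T : topologicalType) := Opens {
  oset :> T -> Prop;
  oset_open : open (oset : set T) }.

Definition sub_opens (T : topologicalType) (U V : opens T) : Prop :=
  forall x, U x -> V x.
Infix "<=o" := sub_opens (at level 70, no associativity).

Definition topO (T : topologicalType) : opens T := Opens (@openT T).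
Definition capO (T : topologicalType) (U V : opens T) : opens T :=
  Opens (openI (oset_open U) (oset_open V)).

Lemma sub_refl T (U : opens T) : U <=o U. Proof. by []. Qed.
Lemma sub_top T (U : opens T) : U <=o topO T. Proof. by []. Qed.
Lemma capOl T (U V : opens T) : capO U V <=o U. Proof. by move=> x []. Qed.
Lemma capOr T (U V : opens T) : capO U V <=o V. Proof. by move=> x []. Qed.
Lemma sub_trans T (U V W : opens T) : U <=o V -> V <=o W -> U <=o W.
Proof. by move=> h k x /h /k. Qed.

Definition is_sheaf (T : topologicalType) (F : opens T -> Type)
    (res : forall U V, V <=o U -> F U -> F V) : Prop :=
  forall (U : opens T) (I : Type) (W : I -> opens T)
    (hW : forall i, W i <=o U),
    (forall x, U x -> exists i, W i x) ->
    (forall s t : F U, (forall i, res _ _ (hW i) s = res _ _ (hW i) t) ->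
       s = t) /\
    (forall s : forall i, F (W i),
       (forall i j V (hi : V <=o W i) (hj : V <=o W j),
          res _ _ hi (s i) = res _ _ hj (s j)) ->
       exists t : F U, forall i, res _ _ (hW i) t = s i).

Record ringedSpace := RingedSpace {
  rs_space :> topologicalType;
  rs_O : opens rs_space -> comPzRingType;
  rs_res : forall U V, V <=o U -> {rmorphism rs_O U -> rs_O V};
  rs_res_id : forall U (h : U <=o U) a, rs_res h a = a;
  rs_res_comp : forall U V W (h : V <=o U) (k : W <=o V) (l : W <=o U) a,
    rs_res k (rs_res h a) = rs_res l a;
  rs_sheaf : is_sheaf (fun U V h => rs_res (U := U) (V := V) h) }.

Notation "\O_ Y" := (@rs_O Y) (at level 8, Y at level 2, format "\O_ Y").

Record module (Y : ringedSpace) := Module {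
  msec :> forall U : opens Y, lmodType (\O_Y U);
  mres : forall U V, V <=o U -> msec U -> msec V;
  mresD : forall U V (h : V <=o U), {morph mres h : m n / m + n};
  mresZ : forall U V (h : V <=o U) (a : \O_Y U) (m : msec U),
    mres h (a *: m) = rs_res h a *: mres h m;
  mres_id : forall U (h : U <=o U) m, mres h m = m;
  mres_comp : forall U V W (h : V <=o U) (k : W <=o V) (l : W <=o U) m,
    mres k (mres h m) = mres l m;
  m_sheaf : is_sheaf (fun U V h => mres (U := U) (V := V) h) }.

Section StructureSheaf.
Variable Y : ringedSpace.
Definition Osec (U : opens Y) : lmodType (\O_Y U) := (\O_Y U)^o.
Definition Ores U V (h : V <=o U) (a : Osec U) : Osec V := rs_res h a.
Lemma OresD U V (h : V <=o U) : {morph Ores h : m n / m + n}.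
Proof. exact: (rmorphD (rs_res h)). Qed.
Lemma OresZ U V (h : V <=o U) (a : \O_Y U) (m : Osec U) :
  Ores h (a *: m) = rs_res h a *: Ores h m.
Proof. exact: (rmorphM (rs_res h)). Qed.
Definition structure_module : module Y :=
  @Module Y Osec Ores OresD OresZ (@rs_res_id Y) (@rs_res_comp Y)
    (@rs_sheaf Y).
End StructureSheaf.

Record mod_hom (Y : ringedSpace) (M N : module Y) := ModHom {
  mh_fun :> forall U : opens Y, {linear M U -> N U};
  mh_nat : forall U V (h : V <=o U) (m : M U),
    mh_fun V (mres h m) = mres h (mh_fun U m) }.

Section HomComp.
Variables (Y : ringedSpace) (M N P : module Y).
Variables (g : mod_hom N P) (f : mod_hom M N).
Lemma hom_comp_nat U V (h : V <=o U) (m : M U) :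
  (g V \o f V) (mres h m) = mres h ((g U \o f U) m).
Proof. by rewrite /= !mh_nat. Qed.
Definition hom_comp : mod_hom M P :=
  @ModHom Y M P (fun U => g U \o f U) hom_comp_nat.
End HomComp.

Section HomId.
Variables (Y : ringedSpace) (M : module Y).
Lemma hom_id_nat U V (h : V <=o U) (m : M U) :
  (idfun : M V -> M V) (mres h m) = mres h (idfun m).
Proof. by []. Qed.
Definition hom_id : mod_hom M M :=
  @ModHom Y M M (fun U => idfun) hom_id_nat.
End HomId.

Definition is_iso (Y : ringedSpace) (M N : module Y) (f : mod_hom M N) : Prop :=
  exists g : mod_hom N M,
    hom_comp g f = hom_id M /\ hom_comp f g = hom_id N.
Definition isomorphic (Y : ringedSpace) (M N : module Y) : Prop :=
  exists f : mod_hom M N, is_iso f.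

(* Locally free of rank one.  An isomorphism from the restriction of [\O_Y]
   to [U] to the restriction of [L] to [U] is multiplication of the sections
   over the open subsets of [U] by a section [e] of [L] over [U]. *)
Definition line_bundle (Y : ringedSpace) (L : module Y) : Prop :=
  forall y : Y, exists U : opens Y, U y /\
    exists e : L U, forall V (h : V <=o U),
      bijective (fun a : \O_Y V => a *: mres h e).

Section Stalk.
Variables (Y : ringedSpace) (y : Y).

Section StalkType.
Variable M : module Y.

Record pregerm := Pregerm {
  pg_open : opens Y;
  pg_in : pg_open y;
  pg_sec : M pg_open }.

HB.instance Definition _ := gen_eqMixin pregerm.
HB.instance Definition _ := gen_choiceMixin pregerm.

Definition germ_rel (p q : pregerm) : Prop :=
  exists (W : opens Y) (_ : W y) (h : W <=o pg_open p) (k : W <=o pg_open q),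
    mres h (pg_sec p) = mres k (pg_sec q).

Definition germ_eqb (p q : pregerm) : bool := `[< germ_rel p q >].

Lemma germ_refl : reflexive germ_eqb.
Proof.
by move=> p; apply/asboolP; exists (pg_open p), (pg_in p), (@sub_refl _ _), (@sub_refl _ _).
Qed.
Lemma germ_sym : symmetric germ_eqb.
Proof.
suff S p q : germ_rel p q -> germ_rel q p.
  by move=> p q; apply/idP/idP => /asboolP h; apply/asboolP; apply: S.
by case=> W [Wy [h [k e]]]; exists W, Wy, k, h.
Qed.
Lemma germ_trans : transitive germ_eqb.
Proof.
move=> q p r /asboolP [W [Wy [h [k e]]]] /asboolP [W' [Wy' [h' [k' e']]]].
apply/asboolP; exists (capO W W'), (conj Wy Wy').
exists (sub_trans (@capOl _ W W') h), (sub_trans (@capOr _ W W') k').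
rewrite -(mres_comp h (@capOl _ W W')) e -(mres_comp k' (@capOr _ W W')) -e'.
by rewrite !(mres_comp _ _ (sub_trans (@capOl _ W W') k)).
Qed.
Definition germ_equiv : equiv_rel pregerm :=
  EquivRel germ_eqb germ_refl germ_sym germ_trans.

Definition stalk := {eq_quot germ_equiv}.
HB.instance Definition _ := Choice.on stalk.

Definition germ (U : opens Y) (Uy : U y) (m : M U) : stalk :=
  \pi_({eq_quot germ_equiv}) (Pregerm Uy m).

Lemma germP (U : opens Y) (Uy : U y) (m : M U) (V : opens Y) (Vy : V y) (n : M V) :
  germ Uy m = germ Vy n <->
  exists (W : opens Y) (_ : W y) (h : W <=o U) (k : W <=o V), mres h m = mres k n.
Proof.
split=> [/eqmodP/asboolP //|H].
by apply/eqmodP/asboolP.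
Qed.

Lemma germ_surj (c : stalk) : exists (U : opens Y) (Uy : U y) (m : M U), c = germ Uy m.
Proof.
elim/quotW: c => -[U Uy m]; by exists U, Uy, m.
Qed.

Lemma germ_res (U V : opens Y) (Uy : U y) (Vy : V y) (h : V <=o U) (m : M U) :
  germ Vy (mres h m) = germ Uy m.
Proof.
apply/germP; exists V, Vy, (@sub_refl _ _), h.
by rewrite mres_id.
Qed.
End StalkType.
End Stalk.
Arguments germ {Y y M U}.

Section Lift2.
Variables (Y : ringedSpace) (y : Y) (A B C : module Y).
Variable op : forall U : opens Y, A U -> B U -> C U.
Hypothesis op_nat : forall U V (h : V <=o U) a b,
  mres h (op a b) = op (mres h a) (mres h b).

Definition stalk_op2 (c : stalk y A) (d : stalk y B) : stalk y C :=
  let p := repr c in let q := repr d in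
  germ (conj (pg_in p) (pg_in q) : capO _ _ y)
    (op (mres (@capOl _ _ _) (pg_sec p)) (mres (@capOr _ _ _) (pg_sec q))).

Lemma stalk_op2E (U : opens Y) (Uy : U y) a b :
  stalk_op2 (germ Uy a) (germ Uy b) = germ Uy (op a b).
Proof.
rewrite /stalk_op2.
case E : (repr (germ Uy a)) => [V Vy a'].
case E' : (repr (germ Uy b)) => [V' Vy' b'] /=.
have : germ Vy a' = germ Uy a by rewrite /germ -E reprK.
have : germ Vy' b' = germ Uy b by rewrite /germ -E' reprK.
move=> /germP [W' [Wy' [h' [k' e']]]] /germP [W [Wy [h [k e]]]].
apply/germP; exists (capO W W'), (conj Wy Wy').
have i : capO W W' <=o capO V V' by move=> z [/h ? /h' ?]; split.
exists i, (sub_trans (@capOl _ W W') k).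
rewrite !op_nat !(mres_comp _ _ (sub_trans (@capOl _ W W') h)).
rewrite !(mres_comp _ _ (sub_trans (@capOr _ W W') h')).
rewrite -(mres_comp h (@capOl _ W W')) -(mres_comp h' (@capOr _ W W')) e e'.
rewrite (mres_comp _ _ (sub_trans (@capOl _ W W') k)).
by rewrite (mres_comp _ _ (sub_trans (@capOl _ W W') k)).
Qed.
End Lift2.

Section CommonGerms.
Variables (Y : ringedSpace) (y : Y).
Lemma germ_surj2 (A B : module Y) (c : stalk y A) (d : stalk y B) :
  exists (U : opens Y) (Uy : U y) a b, c = germ Uy a /\ d = germ Uy b.
Proof.
have [U [Uy [a ->]]] := germ_surj c; have [V [Vy [b ->]]] := germ_surj d.
exists (capO U V), (conj Uy Vy), (mres (@capOl _ _ _) a), (mres (@capOr _ _ _) b).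
by rewrite !germ_res.
Qed.
Lemma germ_surj3 (A B C : module Y) (c : stalk y A) (d : stalk y B)
  (e : stalk y C) : exists (U : opens Y) (Uy : U y) a b c',
  [/\ c = germ Uy a, d = germ Uy b & e = germ Uy c'].
Proof.
have [U [Uy [a [b [-> ->]]]]] := germ_surj2 c d.
have [V [Vy [f ->]]] := germ_surj e.
exists (capO U V), (conj Uy Vy), (mres (@capOl _ _ _) a),
  (mres (@capOl _ _ _) b), (mres (@capOr _ _ _) f).
by rewrite !germ_res.
Qed.
End CommonGerms.

Section StalkZmod.
Variables (Y : ringedSpace) (y : Y) (M : module Y).
Lemma mres0 U V (h : V <=o U) : mres h (0 : M U) = 0.
Proof. by apply: (addrI (mres h 0)); rewrite -mresD !addr0. Qed.
Lemma mresN U V (h : V <=o U) (m : M U) : mres h (- m) = - mres h m.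
Proof. by apply: (addrI (mres h m)); rewrite -mresD !subrr mres0. Qed.

Definition stalk_add : stalk y M -> stalk y M -> stalk y M :=
  stalk_op2 (fun U (m n : M U) => m + n).
Definition stalk_zero : stalk y M := germ (U := topO Y) I 0.
Definition stalk_opp (c : stalk y M) : stalk y M :=
  let p := repr c in germ (pg_in p) (- pg_sec p).

Lemma stalk_addE (U : opens Y) (Uy : U y) (m n : M U) :
  stalk_add (germ Uy m) (germ Uy n) = germ Uy (m + n).
Proof. by apply: stalk_op2E => *; rewrite mresD. Qed.
Lemma stalk_zeroE (U : opens Y) (Uy : U y) : stalk_zero = germ Uy (0 : M U).
Proof. by rewrite -(mres0 (@sub_top _ U)) (germ_res (U := topO Y) I). Qed.
Lemma stalk_oppE (U : opens Y) (Uy : U y) (m : M U) :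
  stalk_opp (germ Uy m) = germ Uy (- m).
Proof.
rewrite /stalk_opp; case E : (repr (germ Uy m)) => [V Vy m'] /=.
have : germ Vy m' = germ Uy m by rewrite /germ -E reprK.
move=> /germP [W [Wy [h [k e]]]]; apply/germP; exists W, Wy, h, k.
by rewrite !mresN e.
Qed.
Lemma stalk_addA : associative stalk_add.
Proof.
move=> c d e; have [U [Uy [a [b [f [-> -> ->]]]]]] := germ_surj3 c d e.
by rewrite !stalk_addE addrA.
Qed.
Lemma stalk_addC : commutative stalk_add.
Proof.
move=> c d; have [U [Uy [a [b [-> ->]]]]] := germ_surj2 c d.
by rewrite !stalk_addE addrC.
Qed.
Lemma stalk_add0 : left_id stalk_zero stalk_add.
Proof.
move=> c; have [U [Uy [a ->]]] := germ_surj c.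
by rewrite (stalk_zeroE Uy) stalk_addE add0r.
Qed.
Lemma stalk_addN : left_inverse stalk_zero stalk_opp stalk_add.
Proof.
move=> c; have [U [Uy [a ->]]] := germ_surj c.
by rewrite (stalk_zeroE Uy) stalk_oppE stalk_addE addNr.
Qed.
HB.instance Definition _ := GRing.isZmodule.Build (stalk y M)
  stalk_addA stalk_addC stalk_add0 stalk_addN.

Lemma germD (U : opens Y) (Uy : U y) (m n : M U) : germ Uy (m + n) = germ Uy m + germ Uy n.
Proof. by rewrite -stalk_addE. Qed.
Lemma germ0 (U : opens Y) (Uy : U y) : germ Uy (0 : M U) = 0.
Proof. by rewrite -stalk_zeroE. Qed.
End StalkZmod.

Section StalkRing.
Variables (Y : ringedSpace) (y : Y).

Definition ostalk := stalk y (structure_module Y).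
HB.instance Definition _ := GRing.Zmodule.on ostalk.

Definition ogerm (U : opens Y) (Uy : U y) (a : \O_Y U) : ostalk :=
  germ (M := structure_module Y) Uy a.

Definition ostalk_mul : ostalk -> ostalk -> ostalk :=
  @stalk_op2 Y y (structure_module Y) (structure_module Y) (structure_module Y)
    (fun U (a b : \O_Y U) => a * b).
Definition ostalk_one : ostalk := ogerm (U := topO Y) I 1.

Lemma ostalk_mulE (U : opens Y) (Uy : U y) (a b : \O_Y U) :
  ostalk_mul (ogerm Uy a) (ogerm Uy b) = ogerm Uy (a * b).
Proof.
apply: stalk_op2E => U' V h c d; exact: (rmorphM (rs_res h)).
Qed.
Lemma ostalk_oneE (U : opens Y) (Uy : U y) : ostalk_one = ogerm Uy (1 : \O_Y U).
Proof.
rewrite /ogerm -[1](rmorph1 (rs_res (@sub_top _ U))).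
exact: esym (@germ_res Y y (structure_module Y) _ _ _ Uy _ _).
Qed.
Lemma ostalk_mulA : associative ostalk_mul.
Proof.
move=> c d e; have [U [Uy [a [b [f [-> -> ->]]]]]] := germ_surj3 c d e.
by rewrite !ostalk_mulE mulrA.
Qed.
Lemma ostalk_mulC : commutative ostalk_mul.
Proof.
move=> c d; have [U [Uy [a [b [-> ->]]]]] := germ_surj2 c d.
by rewrite !ostalk_mulE mulrC.
Qed.
Lemma ostalk_mul1 : left_id ostalk_one ostalk_mul.
Proof.
move=> c; have [U [Uy [a ->]]] := germ_surj c.
by rewrite (ostalk_oneE Uy) ostalk_mulE mul1r.
Qed.
Lemma ostalk_mulD : left_distributive ostalk_mul +%R.
Proof.
move=> c d e; have [U [Uy [a [b [f [-> -> ->]]]]]] := germ_surj3 c d e.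
by rewrite -germD !ostalk_mulE -[RHS]germD mulrDl.
Qed.
HB.instance Definition _ := GRing.Zmodule_isComPzRing.Build ostalk
  ostalk_mulA ostalk_mulC ostalk_mul1 ostalk_mulD.

Lemma ogermD (U : opens Y) (Uy : U y) (a b : \O_Y U) :
  ogerm Uy (a + b) = ogerm Uy a + ogerm Uy b.
Proof. exact: germD. Qed.
Lemma ogermM (U : opens Y) (Uy : U y) (a b : \O_Y U) :
  ogerm Uy (a * b) = ogerm Uy a * ogerm Uy b.
Proof. by rewrite -ostalk_mulE. Qed.
Lemma ogerm1 (U : opens Y) (Uy : U y) : ogerm Uy (1 : \O_Y U) = 1.
Proof. by rewrite -ostalk_oneE. Qed.
Lemma ogerm_res (U V : opens Y) (Uy : U y) (Vy : V y) (h : V <=o U) (a : \O_Y U) :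
  ogerm Vy (rs_res h a) = ogerm Uy a.
Proof. exact: (@germ_res Y y (structure_module Y)). Qed.
End StalkRing.

Section StalkLmod.
Variables (Y : ringedSpace) (y : Y) (M : module Y).
Definition stalk_scale : ostalk y -> stalk y M -> stalk y M :=
  @stalk_op2 Y y (structure_module Y) M M (fun U (a : \O_Y U) m => a *: m).
Lemma stalk_scaleE (U : opens Y) (Uy : U y) (a : \O_Y U) (m : M U) :
  stalk_scale (ogerm Uy a) (germ Uy m) = germ Uy (a *: m).
Proof. by apply: stalk_op2E => U' V h c d; exact: mresZ. Qed.
Lemma stalk_scaleA a b v :
  stalk_scale a (stalk_scale b v) = stalk_scale (a * b) v.
Proof.
have [U [Uy [a' [b' [m [-> -> ->]]]]]] := germ_surj3 a b v.
by rewrite -ogermM !stalk_scaleE scalerA.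
Qed.
Lemma stalk_scale1 : left_id 1 stalk_scale.
Proof.
move=> v; have [U [Uy [m ->]]] := germ_surj v.
by rewrite -(ogerm1 Uy) stalk_scaleE scale1r.
Qed.
Lemma stalk_scaleDr : right_distributive stalk_scale +%R.
Proof.
move=> a v w; have [U [Uy [a' [m [n [-> -> ->]]]]]] := germ_surj3 a v w.
by rewrite -germD !stalk_scaleE -germD scalerDr.
Qed.
Lemma stalk_scaleDl v : {morph stalk_scale^~ v : a b / a + b}.
Proof.
move=> a b; have [U [Uy [a' [b' [m [-> -> ->]]]]]] := germ_surj3 a b v.
by rewrite -ogermD !stalk_scaleE -germD scalerDl.
Qed.
HB.instance Definition _ := GRing.Zmodule_isLmodule.Build (ostalk y) (stalk y M)
  stalk_scaleA stalk_scale1 stalk_scaleDr stalk_scaleDl.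
Lemma germZ (U : opens Y) (Uy : U y) (a : \O_Y U) (m : M U) :
  germ Uy (a *: m) = ogerm Uy a *: germ Uy m.
Proof. by rewrite -stalk_scaleE. Qed.
End StalkLmod.

(* [tens phi E F] is the tensor product over [A] of an [A]-module [E] and a
   [B]-module [F], where [F] is an [A]-module through [phi : A -> B]; it is a
   [B]-module through [F].  With [phi] the identity this is the tensor product
   of two [A]-modules, and with [F] equal to [B] it is the base change of [E].
   It is the quotient of the formal sums of pairs by the relations that hold
   under every balanced map. *)
Section Tensor.
Variables (A B : comPzRingType) (phi : {rmorphism A -> B}).
Variables (E : lmodType A) (F : lmodType B).

Record balanced (P : lmodType B) (b : E -> F -> P) : Prop := Balanced {
  balDl : forall e e' f, b (e + e') f = b e f + b e' f;
  balDr : forall e f f', b e (f + f') = b e f + b e f';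
  balZl : forall a e f, b (a *: e) f = phi a *: b e f;
  balZr : forall c e f, b e (c *: f) = c *: b e f }.

Lemma bal0l P b (H : @balanced P b) f : b 0 f = 0.
Proof. by apply: (addrI (b 0 f)); rewrite -(balDl H) !addr0. Qed.
Lemma balNl P b (H : @balanced P b) e f : b (- e) f = - b e f.
Proof. by apply: (addrI (b e f)); rewrite -(balDl H) !subrr (bal0l H). Qed.

Definition formal_sum : Type := seq (E * F).
HB.instance Definition _ := gen_eqMixin formal_sum.
HB.instance Definition _ := gen_choiceMixin formal_sum.

Definition tsum (P : lmodType B) (b : E -> F -> P) (s : formal_sum) : P :=
  \sum_(p <- (s : seq (E * F))) b p.1 p.2.

Definition tens_rel (s t : formal_sum) : Prop :=
  forall (P : lmodType B) (b : E -> F -> P),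
    balanced b -> tsum b s = tsum b t.
Definition tens_eqb (s t : formal_sum) : bool := `[< tens_rel s t >].
Lemma tens_refl : reflexive tens_eqb.
Proof. by move=> s; apply/asboolP. Qed.
Lemma tens_sym : symmetric tens_eqb.
Proof.
by move=> s t; apply/idP/idP => /asboolP h; apply/asboolP => P b Hb; rewrite h.
Qed.
Lemma tens_trans : transitive tens_eqb.
Proof.
by move=> t s u /asboolP h /asboolP k; apply/asboolP => P b Hb; rewrite h ?k.
Qed.
Definition tens_equiv : equiv_rel formal_sum :=
  EquivRel tens_eqb tens_refl tens_sym tens_trans.

Definition tens := {eq_quot tens_equiv}.
HB.instance Definition _ := Choice.on tens.

Definition tcls (s : formal_sum) : tens := \pi_({eq_quot tens_equiv}) s.
Lemma tclsP s t : tcls s = tcls t <-> tens_rel s t.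
Proof. by split=> [/eqmodP/asboolP //|H]; apply/eqmodP/asboolP. Qed.
Lemma tcls_surj (c : tens) : exists s, c = tcls s.
Proof. by elim/quotW: c => s; exists s. Qed.
Lemma tcls_repr s : tens_rel (repr (tcls s)) s.
Proof. by apply/tclsP; rewrite /tcls reprK. Qed.

Definition tens_add (c d : tens) : tens := tcls (repr c ++ repr d).
Definition tens_zero : tens := tcls [::].
Definition tens_opp (c : tens) : tens :=
  tcls [seq (- p.1, p.2) | p <- repr c].
Definition tens_scale (b : B) (c : tens) : tens :=
  tcls [seq (p.1, b *: p.2) | p <- repr c].

Lemma tsum_cat (P : lmodType B) (b : E -> F -> P) (s t : formal_sum) :
  tsum b (s ++ t) = tsum b s + tsum b t.
Proof. exact: big_cat. Qed.
Lemma tsum_opp (P : lmodType B) (b : E -> F -> P) (Hb : balanced b) s :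
  tsum b [seq (- p.1, p.2) | p <- s] = - tsum b s.
Proof.
by rewrite /tsum big_map -sumrN; apply: eq_bigr => p _; rewrite (balNl Hb).
Qed.
Lemma tsum_scale (P : lmodType B) (b : E -> F -> P) (Hb : balanced b) c s :
  tsum b [seq (p.1, c *: p.2) | p <- s] = c *: tsum b s.
Proof.
by rewrite /tsum big_map scaler_sumr; apply: eq_bigr => p _; rewrite (balZr Hb).
Qed.

Lemma tens_addE s t : tens_add (tcls s) (tcls t) = tcls (s ++ t).
Proof.
by apply/tclsP => P b Hb; rewrite !tsum_cat (tcls_repr s Hb) (tcls_repr t Hb).
Qed.
Lemma tens_oppE s : tens_opp (tcls s) = tcls [seq (- p.1, p.2) | p <- s].
Proof. by apply/tclsP => P b Hb; rewrite !tsum_opp // (tcls_repr s Hb). Qed.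
Lemma tens_scaleE c s : tens_scale c (tcls s) = tcls [seq (p.1, c *: p.2) | p <- s].
Proof. by apply/tclsP => P b Hb; rewrite !tsum_scale // (tcls_repr s Hb). Qed.

Lemma tens_addA : associative tens_add.
Proof.
move=> c d e; have [s ->] := tcls_surj c; have [t ->] := tcls_surj d.
by have [u ->] := tcls_surj e; rewrite !tens_addE catA.
Qed.
Lemma tens_addC : commutative tens_add.
Proof.
move=> c d; have [s ->] := tcls_surj c; have [t ->] := tcls_surj d.
by rewrite !tens_addE; apply/tclsP => P b Hb; rewrite !tsum_cat addrC.
Qed.
Lemma tens_add0 : left_id tens_zero tens_add.
Proof. by move=> c; have [s ->] := tcls_surj c; rewrite tens_addE. Qed.
Lemma tens_addN : left_inverse tens_zero tens_opp tens_add.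
Proof.
move=> c; have [s ->] := tcls_surj c; rewrite tens_oppE tens_addE.
by apply/tclsP => P b Hb; rewrite tsum_cat tsum_opp // addNr [RHS]big_nil.
Qed.
HB.instance Definition _ := GRing.isZmodule.Build tens
  tens_addA tens_addC tens_add0 tens_addN.
Lemma tclsD s t : tcls s + tcls t = tcls (s ++ t).
Proof. exact: tens_addE. Qed.

Lemma tens_scaleA a b v : tens_scale a (tens_scale b v) = tens_scale (a * b) v.
Proof.
have [s ->] := tcls_surj v; rewrite !tens_scaleE.
by apply/tclsP => P g Hg; rewrite !tsum_scale // scalerA.
Qed.
Lemma tens_scale1 : left_id 1 tens_scale.
Proof.
move=> v; have [s ->] := tcls_surj v; rewrite tens_scaleE.
by apply/tclsP => P g Hg; rewrite !tsum_scale // scale1r.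
Qed.
Lemma tens_scaleDr : right_distributive tens_scale +%R.
Proof.
move=> a v w; have [s ->] := tcls_surj v; have [t ->] := tcls_surj w.
rewrite tclsD !tens_scaleE tclsD.
by apply/tclsP => P g Hg; rewrite !tsum_cat !tsum_scale // tsum_cat scalerDr.
Qed.
Lemma tens_scaleDl v : {morph tens_scale^~ v : a b / a + b}.
Proof.
move=> a b; have [s ->] := tcls_surj v; rewrite !tens_scaleE tclsD.
by apply/tclsP => P g Hg; rewrite !tsum_cat !tsum_scale // scalerDl.
Qed.
HB.instance Definition _ := GRing.Zmodule_isLmodule.Build B tens
  tens_scaleA tens_scale1 tens_scaleDr tens_scaleDl.
Lemma tclsZ c s : c *: tcls s = tcls [seq (p.1, c *: p.2) | p <- s].
Proof. exact: tens_scaleE. Qed.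

Definition tpure (e : E) (f : F) : tens := tcls [:: (e, f)].

Lemma tpure_balanced : balanced tpure.
Proof.
have p1 (P : lmodType B) (b : E -> F -> P) e f : tsum b [:: (e, f)] = b e f.
  exact: big_seq1.
split.
- move=> e e' f; apply: etrans (esym (tens_addE [:: (e, f)] [:: (e', f)])).
  apply/tclsP => P b Hb.
  by rewrite tsum_cat !p1 (balDl Hb).
- move=> e f f'; apply: etrans (esym (tens_addE [:: (e, f)] [:: (e, f')])).
  apply/tclsP => P b Hb.
  by rewrite tsum_cat !p1 (balDr Hb).
- move=> a e f; apply: etrans (esym (tens_scaleE _ [:: (e, f)])).
  apply/tclsP => P b Hb.
  by rewrite /= !p1 (balZl Hb) (balZr Hb).
- move=> c e f; apply: etrans (esym (tens_scaleE _ [:: (e, f)])).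
  apply/tclsP => P b Hb.
  by rewrite /= !p1.
Qed.

Lemma tcls_sum s : tcls s = \sum_(p <- s) tpure p.1 p.2.
Proof.
elim: s => [|[e f] s IH]; first by rewrite big_nil.
by rewrite big_cons -IH; exact: esym (tens_addE [:: (e, f)] s).
Qed.

Lemma tens_ind (P : tens -> Prop) : P 0 ->
  (forall e f v, P v -> P (tpure e f + v)) -> forall v, P v.
Proof.
move=> P0 PD v; have [s ->] := tcls_surj v; rewrite tcls_sum.
by elim: s => [|[e f] s IH]; rewrite ?big_nil // big_cons; exact: PD.
Qed.

Section Universal.
Variables (P : lmodType B) (b : E -> F -> P) (Hb : balanced b).
Definition tens_rec (v : tens) : P := tsum b (repr v).
Lemma tens_rec_cls s : tens_rec (tcls s) = tsum b s.
Proof. exact: tcls_repr. Qed.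
Lemma tens_rec_is_linear : linear tens_rec.
Proof.
move=> c v w; have [s ->] := tcls_surj v; have [t ->] := tcls_surj w.
rewrite tclsZ tclsD !tens_rec_cls.
by rewrite tsum_cat tsum_scale.
Qed.
HB.instance Definition _ := GRing.isLinear.Build B tens P *:%R tens_rec
  tens_rec_is_linear.
Definition tens_lift : {linear tens -> P} := tens_rec.
Lemma tens_liftE e f : tens_lift (tpure e f) = b e f.
Proof. by rewrite [LHS]tens_rec_cls; exact: big_seq1. Qed.
End Universal.
End Tensor.
Arguments tpure {A B} phi {E F}.

(* Given an [\O_y]-module [gE y] at each point [y] and functions [gval i] on
   open sets with values in these modules, [gmod] is the sheaf of the functions
   that are locally [\O_Y]-linear combinations of the functions [gval i].  When
   the [gE y] are the stalks of a presheaf of modules generated by the [gval i]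
   this is the sheaf associated to that presheaf. *)
Record generators (Y : ringedSpace) := Generators {
  gE : forall y : Y, lmodType (ostalk y);
  gI : opens Y -> Type;
  gval : forall U, gI U -> forall y, U y -> gE y;
  gval_res : forall U V (h : V <=o U) (i : gI U), exists j : gI V,
    forall y (Vy : V y), gval j Vy = gval i (h y Vy) }.

Section Generated.
Variables (Y : ringedSpace) (G : generators Y).

Definition gcomb (U : opens Y) (c : seq (\O_Y U * gI G U)) (y : Y) (Uy : U y) :
  gE G y := \sum_(p <- c) ogerm Uy p.1 *: gval p.2 Uy.

Definition locally_gcomb (U : opens Y) (s : forall y, U y -> gE G y) : Prop :=
  forall y, U y -> exists (V : opens Y) (_ : V y) (h : V <=o U)
    (c : seq (\O_Y V * gI G V)),
    forall z (Vz : V z), s z (h z Vz) = gcomb c Vz.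

Lemma gcomb_res (U V : opens Y) (h : V <=o U) (c : seq (\O_Y U * gI G U)) :
  exists c' : seq (\O_Y V * gI G V),
    forall z (Vz : V z), gcomb c (h z Vz) = gcomb c' Vz.
Proof.
elim: c => [|[a i] c [c' IH]].
  by exists [::] => z Vz; rewrite /gcomb !big_nil.
have [j Hj] := gval_res h i; exists ((rs_res h a, j) :: c') => z Vz.
have := IH z Vz; rewrite /gcomb !big_cons => -> /=.
by rewrite Hj (ogerm_res (h z Vz)).
Qed.

Record gsec (U : opens Y) := Gsec {
  gfun : forall y, U y -> gE G y;
  gfun_local : locally_gcomb gfun }.
HB.instance Definition _ U := gen_eqMixin (gsec U).
HB.instance Definition _ U := gen_choiceMixin (gsec U).

Lemma gsec_eq (U : opens Y) (s t : gsec U) :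
  (forall y (Uy : U y), gfun s Uy = gfun t Uy) -> s = t.
Proof.
case: s t => [s Hs] [t Ht] /= e.
have {e} e : s = t by apply: functional_extensionality_dep => y;
  apply: functional_extensionality_dep => Uy.
by move: Ht; rewrite -e => Ht; congr Gsec; exact: Prop_irrelevance.
Qed.

Section Ops.
Variable U : opens Y.

Lemma gzero_local : locally_gcomb (fun y (_ : U y) => 0 : gE G y).
Proof.
move=> y Uy; exists U, Uy, (@sub_refl _ _), [::] => z Uz.
by rewrite /gcomb big_nil.
Qed.
Lemma gadd_local (s t : gsec U) :
  locally_gcomb (fun y (Uy : U y) => gfun s Uy + gfun t Uy).
Proof.
move=> y Uy; have [V [Vy [h [c Hc]]]] := gfun_local s Uy.
have [V' [Vy' [h' [c' Hc']]]] := gfun_local t Uy.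
have [d Hd] := gcomb_res (@capOl _ V V') c.
have [d' Hd'] := gcomb_res (@capOr _ V V') c'.
exists (capO V V'), (conj Vy Vy'), (sub_trans (@capOl _ V V') h), (d ++ d').
move=> z Vz; rewrite /gcomb big_cat /= -/(gcomb _ _) -/(gcomb _ _).
rewrite -Hd -Hd' -Hc -Hc'.
by congr (_ + _); congr gfun; exact: Prop_irrelevance.
Qed.
Lemma gscale_local (a : \O_Y U) (s : gsec U) :
  locally_gcomb (fun y (Uy : U y) => ogerm Uy a *: gfun s Uy).
Proof.
move=> y Uy; have [V [Vy [h [c Hc]]]] := gfun_local s Uy.
exists V, Vy, h, [seq (rs_res h a * p.1, p.2) | p <- c] => z Vz.
rewrite Hc /gcomb big_map scaler_sumr; apply: eq_bigr => p _ /=.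
by rewrite ogermM -scalerA (ogerm_res (h z Vz)).
Qed.
Lemma gopp_local (s : gsec U) : locally_gcomb (fun y (Uy : U y) => - gfun s Uy).
Proof.
move=> y Uy; have [V [Vy [h [c Hc]]]] := gscale_local (- 1) s Uy.
exists V, Vy, h, c => z Vz; rewrite -Hc.
have -> : ogerm (h z Vz) (- 1 : \O_Y U) = - 1.
  by apply: (addrI (ogerm (h z Vz) 1)); rewrite -ogermD ogerm1 !subrr [LHS]germ0.
by rewrite scaleN1r.
Qed.

Definition gzero : gsec U := Gsec gzero_local.
Definition gadd s t : gsec U := Gsec (gadd_local s t).
Definition gopp s : gsec U := Gsec (gopp_local s).
Definition gscale a s : gsec U := Gsec (gscale_local a s).

Lemma gaddA : associative gadd.
Proof. by move=> s t u; apply: gsec_eq => y Uy /=; rewrite addrA. Qed.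
Lemma gaddC : commutative gadd.
Proof. by move=> s t; apply: gsec_eq => y Uy /=; rewrite addrC. Qed.
Lemma gadd0 : left_id gzero gadd.
Proof. by move=> s; apply: gsec_eq => y Uy /=; rewrite add0r. Qed.
Lemma gaddN : left_inverse gzero gopp gadd.
Proof. by move=> s; apply: gsec_eq => y Uy /=; rewrite addNr. Qed.
HB.instance Definition _ := GRing.isZmodule.Build (gsec U)
  gaddA gaddC gadd0 gaddN.
Lemma gscaleA a b s : gscale a (gscale b s) = gscale (a * b) s.
Proof. by apply: gsec_eq => y Uy /=; rewrite ogermM scalerA. Qed.
Lemma gscale1 : left_id 1 gscale.
Proof. by move=> s; apply: gsec_eq => y Uy /=; rewrite ogerm1 scale1r. Qed.
Lemma gscaleDr : right_distributive gscale +%R.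
Proof. by move=> a s t; apply: gsec_eq => y Uy /=; rewrite scalerDr. Qed.
Lemma gscaleDl s : {morph gscale^~ s : a b / a + b}.
Proof. by move=> a b; apply: gsec_eq => y Uy /=; rewrite ogermD scalerDl. Qed.
HB.instance Definition _ := GRing.Zmodule_isLmodule.Build (\O_Y U) (gsec U)
  gscaleA gscale1 gscaleDr gscaleDl.
End Ops.

Lemma gres_local (U V : opens Y) (h : V <=o U) (s : gsec U) :
  locally_gcomb (fun y (Vy : V y) => gfun s (h y Vy)).
Proof.
move=> y Vy; have [W [Wy [k [c Hc]]]] := gfun_local s (h y Vy).
have [d Hd] := gcomb_res (@capOl _ W V) c.
exists (capO W V), (conj Wy Vy), (@capOr _ W V), d => z Wz.
by rewrite -Hd -Hc; congr gfun; exact: Prop_irrelevance.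
Qed.
Definition gres U V (h : V <=o U) (s : gsec U) : gsec V :=
  Gsec (gres_local h s).

Lemma gresD U V (h : V <=o U) : {morph gres h : s t / s + t}.
Proof. by move=> s t; apply: gsec_eq. Qed.
Lemma gresZ U V (h : V <=o U) (a : \O_Y U) (s : gsec U) :
  gres h (a *: s) = rs_res h a *: gres h s.
Proof. by apply: gsec_eq => y Vy /=; rewrite (ogerm_res (h y Vy)). Qed.
Lemma gres_id U (h : U <=o U) s : gres h s = s.
Proof.
by apply: gsec_eq => y Uy /=; congr gfun; exact: Prop_irrelevance.
Qed.
Lemma gres_comp U V W (h : V <=o U) (k : W <=o V) (l : W <=o U) s :
  gres k (gres h s) = gres l s.
Proof.
by apply: gsec_eq => y Wy /=; congr gfun; exact: Prop_irrelevance.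
Qed.
Lemma g_sheaf : is_sheaf gres.
Proof.
move=> U I W hW cov; split=> [s t e|s e].
  apply: gsec_eq => y Uy; have [i Wy] := cov y Uy.
  have := congr1 (fun r => gfun r Wy) (e i) => /=.
  by rewrite (Prop_irrelevance (hW i y Wy) Uy).
have e' i j y (hi : W i y) (hj : W j y) : gfun (s i) hi = gfun (s j) hj.
  have := e i j (capO (W i) (W j)) (@capOl _ _ _) (@capOr _ _ _).
  move/(congr1 (fun r : gsec (capO _ _) => gfun r (conj hi hj))) => /=.
  rewrite (Prop_irrelevance (@capOl _ (W i) (W j) y (conj hi hj)) hi) => ->.
  by congr gfun; exact: Prop_irrelevance.
pose f y (Uy : U y) : gE G y :=
  gfun (s (projT1 (cid (cov y Uy)))) (projT2 (cid (cov y Uy))).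
have Hf i y (Wy : W i y) : f y (hW i y Wy) = gfun (s i) Wy by exact: e'.
have Lf : locally_gcomb f.
  move=> y Uy; have [i Wy] := cov y Uy.
  have [V [Vy [h [c Hc]]]] := gfun_local (s i) Wy.
  exists V, Vy, (sub_trans h (hW i)), c => z Vz; rewrite -Hc -Hf.
  by congr f; exact: Prop_irrelevance.
exists (Gsec Lf) => i; apply: gsec_eq => y Wy.
exact (Hf i y Wy).
Qed.

Definition gmod : module Y :=
  @Module Y gsec gres gresD gresZ gres_id gres_comp g_sheaf.

Lemma gen_local (U : opens Y) (i : gI G U) :
  locally_gcomb (fun y (Uy : U y) => gval i Uy).
Proof.
move=> y Uy; exists U, Uy, (@sub_refl _ _), [:: (1, i)] => z Uz.
rewrite /gcomb big_seq1 ogerm1 scale1r.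
by congr gval; exact: Prop_irrelevance.
Qed.
Definition gen_sec (U : opens Y) (i : gI G U) : gmod U := Gsec (gen_local i).

Section Eval.
Variable y : Y.
Definition geval (c : stalk y gmod) : gE G y :=
  let p := repr c in gfun (pg_sec p : gsec _) (pg_in p).
Lemma geval_germ (U : opens Y) (Uy : U y) (s : gsec U) :
  geval (germ (M := gmod) Uy s) = gfun s Uy.
Proof.
rewrite /geval; case E : (repr _) => [V Vy t] /=.
have : germ (M := gmod) Vy t = germ (M := gmod) Uy s by rewrite {1}/germ -E reprK.
move=> /germP [W [Wy [h [k]]]].
move/(congr1 (fun r : gsec W => gfun r Wy)) => /=.
by rewrite (Prop_irrelevance (h y Wy) Vy) (Prop_irrelevance (k y Wy) Uy).
Qed.
Lemma geval_is_linear : linear geval.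
Proof.
move=> a v w; have [U [Uy [a' [s [t [-> -> ->]]]]]] := germ_surj3 a v w.
by rewrite -[germ Uy a']/(ogerm Uy a') -germZ -germD !geval_germ.
Qed.
HB.instance Definition _ := GRing.isLinear.Build (ostalk y) (stalk y gmod)
  (gE G y) *:%R geval geval_is_linear.
End Eval.
End Generated.

Section GeneratedMap.
Variables (Y : ringedSpace) (G G' : generators Y).
Variable h : forall y : Y, {linear gE G y -> gE G' y}.
Hypothesis h_gen : forall (U : opens Y) (i : gI G U),
  locally_gcomb (fun y (Uy : U y) => h y (gval i Uy)).

Lemma gmap_comb (U : opens Y) (c : seq (\O_Y U * gI G U)) :
  locally_gcomb (fun y (Uy : U y) => h y (gcomb c Uy)).
Proof.
elim: c => [|[a i] c IH].
  have := @gzero_local Y G' U; congr locally_gcomb.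
  apply: functional_extensionality_dep => y.
  apply: functional_extensionality_dep => Uy.
  by rewrite /gcomb big_nil linear0.
pose s1 : gsec G' U := Gsec (h_gen i); pose s2 : gsec G' U := Gsec IH.
have := gfun_local (a *: s1 + s2); congr locally_gcomb.
apply: functional_extensionality_dep => y.
apply: functional_extensionality_dep => Uy /=.
by rewrite /gcomb big_cons linearP.
Qed.

Lemma gmap_local (U : opens Y) (s : gsec G U) :
  locally_gcomb (fun y (Uy : U y) => h y (gfun s Uy)).
Proof.
move=> y Uy; have [V [Vy [k [c Hc]]]] := gfun_local s Uy.
have [W [Wy [l [d Hd]]]] := gmap_comb c Vy.
exists W, Wy, (sub_trans l k), d => z Wz; rewrite -Hd -Hc.
by congr (h z (gfun s _)); exact: Prop_irrelevance.
Qed.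

Definition gmap_fun (U : opens Y) (s : gsec G U) : gsec G' U :=
  Gsec (gmap_local s).
Lemma gmap_is_linear U : linear (@gmap_fun U).
Proof. by move=> a s t; apply: gsec_eq => y Uy /=; rewrite linearP. Qed.
HB.instance Definition _ U := GRing.isLinear.Build (\O_Y U) (gsec G U)
  (gsec G' U) *:%R (@gmap_fun U) (@gmap_is_linear U).
Definition gmap : mod_hom (gmod G) (gmod G').
Proof.
by refine (@ModHom Y (gmod G) (gmod G') (fun U => @gmap_fun U) _) => U V k s;
  apply: gsec_eq.
Defined.
End GeneratedMap.

Definition is_unit (R : comPzRingType) (a : R) : Prop := exists b, a * b = 1.

Section Preimage.
Variables (Y X : topologicalType) (f : Y -> X) (cf : continuous f).
Definition preO (U : opens X) : opens Y :=
  Opens (proj1 (continuousP f) cf U (oset_open U)).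
End Preimage.

(* The last field says that the maps induced on stalks reflect units, i.e.
   that they are local homomorphisms. *)
Record morphism (Y X : ringedSpace) := Morphism {
  mor_fun :> Y -> X;
  mor_cont : continuous mor_fun;
  mor_sharp : forall U : opens X, {rmorphism \O_X U -> \O_Y (preO mor_cont U)};
  mor_nat : forall U V (h : V <=o U) (k : preO mor_cont V <=o preO mor_cont U) a,
    mor_sharp V (rs_res h a) = rs_res k (mor_sharp U a);
  mor_local : forall (y : Y) (U : opens X) (Uy : U (mor_fun y)) (a : \O_X U),
    is_unit (ogerm (Uy : preO mor_cont U y) (mor_sharp U a)) ->
    is_unit (ogerm Uy a) }.

Arguments mor_cont {Y X} m.
Arguments mor_sharp {Y X} m U.

Notation "f @^-1o U" := (preO (mor_cont f) U) (at level 24, right associativity).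

Section IdMorphism.
Variable X : ringedSpace.
Lemma id_cont : continuous (id : X -> X). Proof. by move=> x. Qed.
Lemma id_pre (U : opens X) : preO id_cont U <=o U. Proof. by []. Qed.
Definition id_sharp (U : opens X) : {rmorphism \O_X U -> \O_X (preO id_cont U)} :=
  rs_res (@id_pre U).
Lemma id_nat U V (h : V <=o U) (k : preO id_cont V <=o preO id_cont U) a :
  id_sharp V (rs_res h a) = rs_res k (id_sharp U a).
Proof.
have l : preO id_cont V <=o U by move=> x /h.
by rewrite !(rs_res_comp _ _ l).
Qed.
Lemma id_local (y : X) (U : opens X) (Uy : U y) (a : \O_X U) :
  is_unit (ogerm (Uy : preO id_cont U y) (id_sharp U a)) ->
  is_unit (ogerm Uy a).
Proof. by rewrite ogerm_res. Qed.
Definition id_mor : morphism X X := Morphism id_nat id_local.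
End IdMorphism.

Section CompMorphism.
Variables (Z Y X : ringedSpace) (g : morphism Y X) (f : morphism Z Y).
Lemma comp_cont : continuous (g \o f).
Proof.
by move=> z; apply: continuous_comp; [exact: mor_cont | exact: mor_cont].
Qed.
Lemma comp_pre (U : opens X) : preO comp_cont U <=o f @^-1o (g @^-1o U).
Proof. by []. Qed.
Definition comp_sharp (U : opens X) :
    {rmorphism \O_X U -> \O_Z (preO comp_cont U)} :=
  rs_res (@comp_pre U) \o (mor_sharp f (g @^-1o U) \o mor_sharp g U).
Lemma comp_nat U V (h : V <=o U) (k : preO comp_cont V <=o preO comp_cont U) a :
  comp_sharp V (rs_res h a) = rs_res k (comp_sharp U a).
Proof.
have hg : g @^-1o V <=o g @^-1o U by move=> y /h.
have hf : f @^-1o (g @^-1o V) <=o f @^-1o (g @^-1o U) by move=> y /h.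
have l : preO comp_cont V <=o f @^-1o (g @^-1o U) by move=> y /h.
by rewrite /= (mor_nat h hg) (mor_nat hg hf) !(rs_res_comp _ _ l).
Qed.
Lemma comp_local (z : Z) (U : opens X) (Uz : U (g (f z))) (a : \O_X U) :
  is_unit (ogerm (Uz : preO comp_cont U z) (comp_sharp U a)) ->
  is_unit (ogerm Uz a).
Proof.
rewrite /= (ogerm_res (Uz : (f @^-1o (g @^-1o U)) z)) => H.
by apply: mor_local; apply: mor_local; exact: H.
Qed.
Definition comp_mor : morphism Z X := Morphism comp_nat comp_local.
End CompMorphism.

Section StalkMap.
Variables (Y X : ringedSpace) (f : morphism Y X) (y : Y).
Definition stalk_map_fun (c : ostalk (f y)) : ostalk y :=
  let p := repr (c : stalk (f y) (structure_module X)) in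
  ogerm (pg_in p : (f @^-1o (pg_open p)) y) (mor_sharp f _ (pg_sec p)).
Lemma stalk_map_germ (U : opens X) (Uy : U (f y)) (a : \O_X U) :
  stalk_map_fun (ogerm Uy a) = ogerm (Uy : (f @^-1o U) y) (mor_sharp f U a).
Proof.
rewrite /stalk_map_fun; case E : (repr _) => [V Vy b] /=.
have : germ (M := structure_module X) Vy b = germ (M := structure_module X) Uy a.
  by rewrite {1}/germ -E reprK.
move=> /germP [W [Wy [h [k e]]]].
have h' : f @^-1o W <=o f @^-1o V by move=> z /h.
have k' : f @^-1o W <=o f @^-1o U by move=> z /k.
rewrite -(ogerm_res _ (Wy : (f @^-1o W) y) h').
rewrite -(ogerm_res (Uy : (f @^-1o U) y) (Wy : (f @^-1o W) y) k').
by rewrite -(mor_nat h) -(mor_nat k); congr (ogerm _ (mor_sharp f W _)).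
Qed.
Lemma stalk_map_is_zmod_morphism : zmod_morphism stalk_map_fun.
Proof.
move=> c d; have [U [Uy [a [b [-> ->]]]]] := germ_surj2 c d.
have E (t : \O_X U) : germ (M := structure_module X) Uy t = ogerm Uy t by [].
have N (Z : ringedSpace) (z : Z) (V : opens Z) (Vz : V z) (s t : \O_Z V) :
    ogerm Vz (s - t) = ogerm Vz s - ogerm Vz t.
  by apply: (addIr (ogerm Vz t)); rewrite -ogermD !subrK.
by rewrite !E -N !stalk_map_germ rmorphB N.
Qed.
Lemma stalk_map_is_monoid_morphism : monoid_morphism stalk_map_fun.
Proof.
split.
  by rewrite -(ogerm1 (I : topO X (f y))) stalk_map_germ rmorph1 ogerm1.
move=> c d; have [U [Uy [a [b [-> ->]]]]] := germ_surj2 c d.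
have E (t : \O_X U) : germ (M := structure_module X) Uy t = ogerm Uy t by [].
by rewrite !E -ogermM !stalk_map_germ rmorphM ogermM.
Qed.
HB.instance Definition _ := GRing.isZmodMorphism.Build (ostalk (f y)) (ostalk y)
  stalk_map_fun stalk_map_is_zmod_morphism.
HB.instance Definition _ := GRing.isMonoidMorphism.Build (ostalk (f y)) (ostalk y)
  stalk_map_fun stalk_map_is_monoid_morphism.
Definition stalk_map : {rmorphism ostalk (f y) -> ostalk y} := stalk_map_fun.
End StalkMap.

Section StalkHom.
Variables (Y : ringedSpace) (M N : module Y) (g : mod_hom M N) (y : Y).
Definition stalk_hom_fun (c : stalk y M) : stalk y N :=
  let p := repr c in germ (pg_in p) (g _ (pg_sec p)).
Lemma stalk_hom_germ (U : opens Y) (Uy : U y) (m : M U) :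
  stalk_hom_fun (germ Uy m) = germ Uy (g U m).
Proof.
rewrite /stalk_hom_fun; case E : (repr _) => [V Vy n] /=.
have : germ Vy n = germ Uy m by rewrite {1}/germ -E reprK.
move=> /germP [W [Wy [h [k e]]]]; apply/germP; exists W, Wy, h, k.
by rewrite -!mh_nat e.
Qed.
Lemma stalk_hom_is_linear : linear stalk_hom_fun.
Proof.
move=> a v w; have [U [Uy [a' [m [n [-> -> ->]]]]]] := germ_surj3 a v w.
by rewrite -[germ Uy a']/(ogerm Uy a') -germZ -germD !stalk_hom_germ linearP
  germD germZ.
Qed.
HB.instance Definition _ := GRing.isLinear.Build (ostalk y) (stalk y M)
  (stalk y N) *:%R stalk_hom_fun stalk_hom_is_linear.
Definition stalk_hom : {linear stalk y M -> stalk y N} := stalk_hom_fun.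
End StalkHom.

(* The stalk of the presheaf [fun U => M U (x) N U] at [y] is the tensor product
   of the stalks of [M] and [N]. *)
Section TensorSheaf.
Variables (Y : ringedSpace) (M N : module Y).
Definition tensor_val (U : opens Y) (mn : M U * N U) (y : Y) (Uy : U y) :
  tens (idfun : {rmorphism ostalk y -> ostalk y}) (stalk y M) (stalk y N) :=
  tpure _ (germ Uy mn.1) (germ Uy mn.2).
Lemma tensor_val_res U V (h : V <=o U) (mn : M U * N U) : exists mn' : M V * N V,
  forall y (Vy : V y), tensor_val mn' Vy = tensor_val mn (h y Vy).
Proof.
exists (mres h mn.1, mres h mn.2) => y Vy.
by rewrite /tensor_val /= !(germ_res (h y Vy)).
Qed.
Definition tensor_generators : generators Y := Generators tensor_val_res.
Definition tensor : module Y := gmod tensor_generators.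
Definition tensor_sec (U : opens Y) (m : M U) (n : N U) : tensor U :=
  @gen_sec Y tensor_generators U (m, n).

Definition tensor_germ (y : Y) (c : stalk y M) (d : stalk y N) :
    stalk y tensor :=
  stalk_op2 tensor_sec c d.
Lemma tensor_germE (y : Y) (U : opens Y) (Uy : U y) (m : M U) (n : N U) :
  tensor_germ (germ Uy m) (germ Uy n) = germ Uy (tensor_sec m n).
Proof.
apply: stalk_op2E => U' V h a b; apply: gsec_eq => z Vz /=.
by rewrite /tensor_val /= !(germ_res (h z Vz)).
Qed.
Lemma tensor_germ_balanced (y : Y) :
  balanced (idfun : {rmorphism ostalk y -> ostalk y}) (@tensor_germ y).
Proof.
split.
- move=> c d e; have [U [Uy [a [b [f [-> -> ->]]]]]] := germ_surj3 c d e.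
  rewrite -germD !tensor_germE -germD; congr germ; apply: gsec_eq => z Uz /=.
  by rewrite /tensor_val /= germD (balDl (tpure_balanced _ _ _)).
- move=> c d e; have [U [Uy [a [b [f [-> -> ->]]]]]] := germ_surj3 c d e.
  rewrite -germD !tensor_germE -germD; congr germ; apply: gsec_eq => z Uz /=.
  by rewrite /tensor_val /= germD (balDr (tpure_balanced _ _ _)).
- move=> c d e; have [U [Uy [a [b [f [-> -> ->]]]]]] := germ_surj3 c d e.
  rewrite -[germ Uy a]/(ogerm Uy a) /= -germZ !tensor_germE -germZ.
  congr germ; apply: gsec_eq => z Uz /=.
  by rewrite /tensor_val /= germZ (balZl (tpure_balanced _ _ _)).
- move=> c d e; have [U [Uy [a [b [f [-> -> ->]]]]]] := germ_surj3 c d e.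
  rewrite -[germ Uy a]/(ogerm Uy a) /= -germZ !tensor_germE -germZ.
  congr germ; apply: gsec_eq => z Uz /=.
  by rewrite /tensor_val /= germZ (balZr (tpure_balanced _ _ _)).
Qed.
End TensorSheaf.

Notation "M ⊗ N" := (tensor M N) (at level 40, left associativity).

Section TensMap.
Variables (A B : comPzRingType) (phi : {rmorphism A -> B}).
Variables (E E' : lmodType A) (F F' : lmodType B).
Variables (g : {linear E -> E'}) (k : {linear F -> F'}).
Lemma tens_map_balanced :
  balanced phi (fun e f => tpure phi (g e) (k f) : tens phi E' F').
Proof.
have H := tpure_balanced phi E' F'; split=> *.
- by rewrite linearD (balDl H).
- by rewrite linearD (balDr H).
- by rewrite linearZ (balZl H).
- by rewrite linearZ (balZr H).
Qed.
Definition tens_map : {linear tens phi E F -> tens phi E' F'} :=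
  tens_lift tens_map_balanced.
Lemma tens_map_pure e f : tens_map (tpure phi e f) = tpure phi (g e) (k f).
Proof. exact: tens_liftE. Qed.
End TensMap.

Section TensorMap.
Variables (Y : ringedSpace) (M M' N N' : module Y).
Variables (g : mod_hom M M') (k : mod_hom N N').
Definition tensor_map_stalk (y : Y) :
    {linear gE (tensor_generators M N) y -> gE (tensor_generators M' N') y} :=
  tens_map _ (stalk_hom g y) (stalk_hom k y).
Lemma tensor_map_gen (U : opens Y) (mn : gI (tensor_generators M N) U) :
  locally_gcomb (G := tensor_generators M' N')
    (fun y (Uy : U y) => tensor_map_stalk y (gval mn Uy)).
Proof.
have := @gen_local Y (tensor_generators M' N') U (g U mn.1, k U mn.2).
congr locally_gcomb; apply: functional_extensionality_dep => y.
apply: functional_extensionality_dep => Uy.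
rewrite [RHS]tens_map_pure.
by congr tpure; rewrite [RHS]stalk_hom_germ.
Qed.
Definition tensor_map : mod_hom (M ⊗ N) (M' ⊗ N') := gmap tensor_map_gen.
End TensorMap.

(* The stalk at [y] of the inverse image of [L] by [f] is the stalk of [L] at
   [f y], and the stalk at [y] of the pullback is its base change to [ostalk y].
   A section of [L] over [V] gives a section of the pullback over each open
   subset of the preimage of [V]. *)
Record pull_index (Y X : ringedSpace) (f : morphism Y X) (L : module X)
    (U : opens Y) := PullIndex {
  pi_open : opens X;
  pi_sub : U <=o f @^-1o pi_open;
  pi_sec : L pi_open }.

Section Pullback.
Variables (Y X : ringedSpace) (f : morphism Y X) (L : module X).
Definition pull_val (U : opens Y) (i : pull_index f L U) (y : Y) (Uy : U y) :
    tens (stalk_map f y) (stalk (f y) L) ((ostalk y)^o) :=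
  tpure (F := (ostalk y)^o) (stalk_map f y)
    (germ (pi_sub i Uy : pi_open i (f y)) (pi_sec i)) (1 : ostalk y).
Lemma pull_val_res U V (h : V <=o U) (i : pull_index f L U) :
  exists j : pull_index f L V,
    forall y (Vy : V y), pull_val j Vy = pull_val i (h y Vy).
Proof.
exists (PullIndex (sub_trans h (@pi_sub _ _ _ _ _ i)) (pi_sec i)) => y Vy.
by congr (tpure _ (germ _ _) _); exact: Prop_irrelevance.
Qed.
Definition pull_generators : generators Y := Generators pull_val_res.
Definition pull : module Y := gmod pull_generators.
Definition pull_sec (V : opens X) (l : L V) : pull (f @^-1o V) :=
  @gen_sec Y pull_generators (f @^-1o V) (PullIndex (@sub_refl _ (f @^-1o V)) l).
End Pullback.

Section PullMap.
Variables (Y X : ringedSpace) (f : morphism Y X) (L L' : module X).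
Variable g : mod_hom L L'.
Definition pull_map_stalk (y : Y) :
    {linear gE (pull_generators f L) y -> gE (pull_generators f L') y} :=
  tens_map (stalk_map f y) (stalk_hom g (f y))
    (idfun : {linear (ostalk y)^o -> (ostalk y)^o}).
Lemma pull_map_gen (U : opens Y) (i : gI (pull_generators f L) U) :
  locally_gcomb (G := pull_generators f L')
    (fun y (Uy : U y) => pull_map_stalk y (gval i Uy)).
Proof.
have := @gen_local Y (pull_generators f L') U
  (PullIndex (@pi_sub _ _ _ _ _ i) (g _ (pi_sec i))).
congr locally_gcomb; apply: functional_extensionality_dep => y.
apply: functional_extensionality_dep => Uy.
rewrite [RHS]tens_map_pure.
by congr tpure; rewrite [RHS]stalk_hom_germ.
Qed.
Definition pull_map : mod_hom (pull f L) (pull f L') := gmap pull_map_gen.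
End PullMap.

(* A bilinear map [b : E -> F -> G] of [A]-modules extends to the base changes
   by [(e (x) c, e' (x) d) |-> b e e' (x) c d]. *)
Section BaseChangeBilinear.
Variables (A B : comPzRingType) (phi : {rmorphism A -> B}).
Variables (E F G : lmodType A) (b : E -> F -> G).
Hypothesis Hb : balanced (idfun : {rmorphism A -> A}) b.
Local Notation bc M := (tens phi M (B^o : lmodType B)).

Lemma bc_inner_balanced (e : E) (c : B) :
  balanced phi (fun (f : F) (d : B^o) => tpure (F := B^o) phi (b e f) (c * d : B) : bc G).
Proof.
have H := tpure_balanced phi G (B^o); split=> *.
- by rewrite (balDr Hb) (balDl H).
- by rewrite mulrDr (balDr H).
- by rewrite (balZr Hb) (balZl H).
- by rewrite -(balZr H); congr tpure; rewrite [RHS]mulrCA.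
Qed.
Definition bc_inner (e : E) (c : B^o) : {linear bc F -> bc G} :=
  tens_lift (bc_inner_balanced e c).
Lemma bc_inner_pure e c f d :
  bc_inner e c (tpure phi f d) = tpure (F := B^o) phi (b e f) (c * d : B).
Proof. exact: tens_liftE. Qed.

Lemma bc_outer_balanced (q : bc F) : balanced phi (fun e c => bc_inner e c q).
Proof.
have H := tpure_balanced phi G (B^o); split.
- move=> e e' c; elim/tens_ind: q => [|f d q IH]; first by rewrite !linear0 addr0.
  by rewrite !linearD /= !bc_inner_pure IH (balDl Hb) (balDl H) addrACA.
- move=> e c c'; elim/tens_ind: q => [|f d q IH]; first by rewrite !linear0 addr0.
  by rewrite !linearD /= !bc_inner_pure IH mulrDl (balDr H) addrACA.
- move=> a e c; elim/tens_ind: q => [|f d q IH]; first by rewrite !linear0 ?scaler0.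
  by rewrite !linearD /= !bc_inner_pure IH ?scalerDr (balZl Hb) (balZl H).
- move=> a e c; elim/tens_ind: q => [|f d q IH]; first by rewrite !linear0 ?scaler0.
  rewrite !linearD /= !bc_inner_pure IH ?scalerDr -(balZr H).
  by congr (tpure _ _ _ + _); exact: (esym (mulrA _ _ _)).
Qed.
Definition bc_bilin (p : bc E) (q : bc F) : bc G :=
  tens_lift (bc_outer_balanced q) p.
Lemma bc_bilinDl p p' q : bc_bilin (p + p') q = bc_bilin p q + bc_bilin p' q.
Proof. by rewrite /bc_bilin linearD. Qed.
Lemma bc_bilin_purel e c q : bc_bilin (tpure phi e c) q = bc_inner e c q.
Proof. exact: tens_liftE. Qed.
Lemma bc_bilin_pure e c f d :
  bc_bilin (tpure phi e c) (tpure phi f d) = tpure (F := B^o) phi (b e f) (c * d : B).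
Proof. by rewrite bc_bilin_purel bc_inner_pure. Qed.
Lemma bc_bilin_balanced : balanced (idfun : {rmorphism B -> B}) bc_bilin.
Proof.
split.
- exact: bc_bilinDl.
- move=> p q q'; elim/tens_ind: p => [|e c p IH].
    by rewrite /bc_bilin !linear0 addr0.
  by rewrite !bc_bilinDl IH !bc_bilin_purel linearD addrACA.
- by move=> a p q; rewrite /bc_bilin linearZ.
- move=> a p q; elim/tens_ind: p => [|e c p IH].
    by rewrite /bc_bilin !linear0 ?scaler0.
  by rewrite !bc_bilinDl IH !bc_bilin_purel linearZ scalerDr.
Qed.
End BaseChangeBilinear.

(* The canonical map from the tensor product of the pullbacks of [M] and [N] to
   the pullback of their tensor product. *)
Section PullTensor.
Variables (Y X : ringedSpace) (f : morphism Y X) (M N : module X).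

Definition pull_bilin (y : Y) :=
  @bc_bilin _ _ (stalk_map f y) _ _ _ _ (tensor_germ_balanced M N (f y)).

Lemma pull_bilin_gen (U : opens Y) (i : pull_index f M U) (j : pull_index f N U) :
  locally_gcomb (G := pull_generators f (M ⊗ N))
    (fun y (Uy : U y) => pull_bilin (pull_val i Uy) (pull_val j Uy)).
Proof.
have sub : U <=o f @^-1o (capO (pi_open i) (pi_open j)).
  by move=> y Uy; split; exact: (pi_sub _ Uy).
have := @gen_local Y (pull_generators f (M ⊗ N)) U (PullIndex sub
  (tensor_sec (mres (@capOl _ _ _) (pi_sec i)) (mres (@capOr _ _ _) (pi_sec j)))).
congr locally_gcomb; apply: functional_extensionality_dep => y.
apply: functional_extensionality_dep => Uy.
rewrite /= /pull_val /pull_bilin bc_bilin_pure mulr1 /=; congr tpure.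
have k : capO (pi_open i) (pi_open j) (f y) by exact: sub.
rewrite -(@germ_res _ (f y) _ _ _ (pi_sub i Uy) k (@capOl _ _ _)).
rewrite -(@germ_res _ (f y) _ _ _ (pi_sub j Uy) k (@capOr _ _ _)) tensor_germE.
by congr germ; exact: Prop_irrelevance.
Qed.

Lemma locally_gcombP (G : generators Y) (U : opens Y)
    (s : forall y, U y -> gE G y) :
  (forall y, U y -> exists (V : opens Y) (_ : V y) (h : V <=o U),
     locally_gcomb (fun z (Vz : V z) => s z (h z Vz))) -> locally_gcomb s.
Proof.
move=> H y Uy; have [V [Vy [h K]]] := H y Uy.
have [W [Wy [k [c Hc]]]] := K y Vy.
exists W, Wy, (sub_trans k h), c => z Wz; rewrite -Hc.
by congr s; exact: Prop_irrelevance.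
Qed.

Lemma pull_bilin_comb (U : opens Y)
    (c : seq (\O_Y U * gI (pull_generators f M) U))
    (d : seq (\O_Y U * gI (pull_generators f N) U)) :
  locally_gcomb (G := pull_generators f (M ⊗ N))
    (fun y (Uy : U y) => pull_bilin (gcomb c Uy) (gcomb d Uy)).
Proof.
have Hb y := bc_bilin_balanced (stalk_map f y) (tensor_germ_balanced M N (f y)).
have Hr y p : pull_bilin p (0 : gE (pull_generators f N) y) = 0.
  by apply: (addrI (pull_bilin p 0)); rewrite -(balDr (Hb y)) !addr0.
elim: c => [|[a i] c IHc].
  have := @gzero_local Y (pull_generators f (M ⊗ N)) U; congr locally_gcomb.
  apply: functional_extensionality_dep => y.
  apply: functional_extensionality_dep => Uy.
  by rewrite /gcomb big_nil [RHS](bal0l (Hb y)).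
have H1 : locally_gcomb (G := pull_generators f (M ⊗ N))
    (fun y (Uy : U y) => pull_bilin (gval i Uy) (gcomb d Uy)).
  elim: d {IHc} => [|[a' j] d IHd].
    have := @gzero_local Y (pull_generators f (M ⊗ N)) U; congr locally_gcomb.
    apply: functional_extensionality_dep => y.
    apply: functional_extensionality_dep => Uy.
    by rewrite /gcomb big_nil Hr.
  pose s1 := Gsec (pull_bilin_gen i j).
  have := gfun_local (a' *: s1 + Gsec IHd); congr locally_gcomb.
  apply: functional_extensionality_dep => y.
  apply: functional_extensionality_dep => Uy /=.
  by rewrite /gcomb big_cons [RHS](balDr (Hb y)) /= [X in _ = X + _](balZr (Hb y)).
have := gfun_local (a *: Gsec H1 + Gsec IHc); congr locally_gcomb.
apply: functional_extensionality_dep => y.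
apply: functional_extensionality_dep => Uy /=.
by rewrite /gcomb big_cons [RHS](balDl (Hb y)) /= [X in _ = X + _](balZl (Hb y)).
Qed.

Lemma pull_tensor_balanced (y : Y) :
  balanced (idfun : {rmorphism ostalk y -> ostalk y})
    (fun (p : stalk y (pull f M)) (q : stalk y (pull f N)) =>
       pull_bilin (geval p) (geval q)).
Proof.
have Hb := bc_bilin_balanced (stalk_map f y) (tensor_germ_balanced M N (f y)).
split=> *.
- by rewrite linearD; exact: (balDl Hb).
- by rewrite linearD; exact: (balDr Hb).
- by rewrite linearZ; exact: (balZl Hb).
- by rewrite linearZ; exact: (balZr Hb).
Qed.

Definition pull_tensor_stalk (y : Y) :
    {linear gE (tensor_generators (pull f M) (pull f N)) y
       -> gE (pull_generators f (M ⊗ N)) y} :=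
  tens_lift (pull_tensor_balanced y).

Lemma pull_tensor_gen (U : opens Y)
    (i : gI (tensor_generators (pull f M) (pull f N)) U) :
  locally_gcomb (G := pull_generators f (M ⊗ N))
    (fun y (Uy : U y) => pull_tensor_stalk y (gval i Uy)).
Proof.
case: i => p q; apply: locally_gcombP => y Uy.
have [V [Vy [h [c Hc]]]] := gfun_local p Uy.
have [V' [Vy' [h' [c' Hc']]]] := gfun_local q Uy.
have [d Hd] := gcomb_res (@capOl _ V V') c.
have [d' Hd'] := gcomb_res (@capOr _ V V') c'.
exists (capO V V'), (conj Vy Vy'), (sub_trans (@capOl _ V V') h).
have := pull_bilin_comb d d'; congr locally_gcomb.
apply: functional_extensionality_dep => z.
apply: functional_extensionality_dep => Vz.
rewrite [RHS](tens_liftE (pull_tensor_balanced z)) /= !geval_germ -Hd -Hd' -Hc -Hc'.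
by congr (pull_bilin (gfun p _) (gfun q _)); exact: Prop_irrelevance.
Qed.

Definition pull_tensor : mod_hom (pull f M ⊗ pull f N) (pull f (M ⊗ N)) :=
  gmap pull_tensor_gen.

Lemma pull_tensor_sec (V : opens X) (m : M V) (n : N V) :
  pull_tensor _ (tensor_sec (pull_sec f m) (pull_sec f n)) =
  pull_sec f (tensor_sec m n).
Proof.
apply: gsec_eq => y Vy.
rewrite [LHS](tens_liftE (pull_tensor_balanced y)) /= !geval_germ /=.
rewrite /pull_bilin /pull_val /= bc_bilin_pure mulr1.
by congr tpure; exact: tensor_germE.
Qed.
End PullTensor.

Section Ideals.
Variable R : comPzRingType.
Definition is_ideal (I : R -> Prop) : Prop :=
  [/\ I 0, forall a b, I a -> I b -> I (a + b) & forall a b, I b -> I (a * b)].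
Definition is_prime_ideal (I : R -> Prop) : Prop :=
  [/\ is_ideal I, ~ I 1 & forall a b, I (a * b) -> I a \/ I b].
Definition generates (n : nat) (g : 'I_n -> R) (I : R -> Prop) : Prop :=
  forall a, I a <-> exists c : 'I_n -> R, a = \sum_(i < n) c i * g i.
Definition noetherian_ring : Prop :=
  forall I, is_ideal I -> exists n (g : 'I_n -> R), generates g I.
(* A chain of prime ideals with [n] strict inclusions. *)
Definition prime_chain (n : nat) : Prop :=
  exists p : nat -> R -> Prop,
    (forall i, (i <= n)%N -> is_prime_ideal (p i)) /\
    (forall i, (i < n)%N ->
       (forall a, p i a -> p i.+1 a) /\ exists a, p i.+1 a /\ ~ p i a).
Definition krull_dim (d : nat) : Prop := prime_chain d /\ ~ prime_chain d.+1.
Definition local_ring : Prop := is_ideal (fun a : R => ~ is_unit a).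
Definition regular_local_ring : Prop :=
  [/\ noetherian_ring, local_ring
    & exists d, krull_dim d /\
        exists g : 'I_d -> R, generates g (fun a => ~ is_unit a)].
End Ideals.

(* [phi] exhibits [B] as the localization of [A] at the powers of [a]. *)
Definition is_localization (A B : comPzRingType) (phi : A -> B) (a : A) : Prop :=
  [/\ is_unit (phi a),
      forall b, exists n c, b * phi a ^+ n = phi c
    & forall c, phi c = 0 -> exists n, a ^+ n * c = 0].

(* Polynomial expressions; the polynomial rings of the library require a
   nonzero coefficient ring. *)
Inductive pexpr (R : Type) (n : nat) : Type :=
| PConst of R
| PVar of 'I_n
| PAdd of pexpr R n & pexpr R n
| PMul of pexpr R n & pexpr R n.
Arguments PConst {R n}.
Arguments PVar {R n}.

Fixpoint peval (R A : comPzRingType) (n : nat) (phi : R -> A) (x : 'I_n -> A)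
    (p : pexpr R n) : A :=
  match p with
  | PConst r => phi r
  | PVar i => x i
  | PAdd p q => peval phi x p + peval phi x q
  | PMul p q => peval phi x p * peval phi x q
  end.

Fixpoint pderiv (R : comPzRingType) (n : nat) (i : 'I_n) (p : pexpr R n) :
    pexpr R n :=
  match p with
  | PConst r => PConst 0
  | PVar j => PConst (if j == i then 1 else 0)
  | PAdd p q => PAdd (pderiv i p) (pderiv i q)
  | PMul p q => PAdd (PMul (pderiv i p) q) (PMul p (pderiv i q))
  end.

(* The [R]-algebra [A], with the elements [x], is the quotient of the polynomial
   ring in [n] variables by the ideal generated by [f]. *)
Definition is_presentation (R A : comPzRingType) (phi : {rmorphism R -> A})
    (n c : nat) (f : 'I_c -> pexpr R n) (x : 'I_n -> A) : Prop :=
  (forall j, peval phi x (f j) = 0) /\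
  forall (B : comPzRingType) (psi : {rmorphism R -> B}) (z : 'I_n -> B),
    (forall j, peval psi z (f j) = 0) ->
    exists g : {rmorphism A -> B},
      [/\ forall r, g (phi r) = psi r, forall i, g (x i) = z i
        & forall g' : {rmorphism A -> B}, (forall r, g' (phi r) = psi r) ->
            (forall i, g' (x i) = z i) -> g' =1 g].

Definition standard_smooth (R A : comPzRingType) (phi : {rmorphism R -> A}) :
    Prop :=
  exists n c (f : 'I_c -> pexpr R (c + n)) (x : 'I_(c + n) -> A),
    is_presentation phi f x /\
    is_unit (\det (\matrix_(i < c, j < c)
      peval phi x (pderiv (lshift n i) (f j)))).

(* The restriction of [Y] to [U] is isomorphic to the spectrum of [\O_Y U].  The
   homeomorphism sends a point to a prime ideal; the structure sheaf of a
   spectrum is characterized by its values on the basic open sets, which are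
   localizations. *)
Definition is_affine (Y : ringedSpace) (U : opens Y) : Prop :=
  exists h : Y -> \O_Y U -> Prop,
    [/\ forall y, U y -> is_prime_ideal (h y),
        forall p, is_prime_ideal p ->
          exists y, [/\ U y, forall a, h y a <-> p a
            & forall z, U z -> (forall a, h z a <-> p a) -> z = y],
        forall V : opens Y, V <=o U ->
          exists S : \O_Y U -> Prop,
            forall y, U y -> (V y <-> exists a, S a /\ ~ h y a)
      & forall a, exists (D : opens Y) (k : D <=o U),
          (forall y, D y <-> U y /\ ~ h y a) /\ is_localization (rs_res k) a].

Record scheme := Scheme {
  sch_space :> ringedSpace;
  sch_affine : forall y : sch_space,
    exists U : opens sch_space, U y /\ is_affine U }.

Definition noetherian_scheme (Y : scheme) : Prop :=
  exists n (U : 'I_n -> opens Y),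
    (forall y, exists i, U i y) /\
    (forall i, is_affine (U i) /\ noetherian_ring (\O_Y (U i))).

Definition regular_scheme (Y : scheme) : Prop :=
  forall y : Y, regular_local_ring (ostalk y).

Definition irreducible_set (T : topologicalType) (Z : set T) : Prop :=
  (exists y, Z y) /\
  forall A B : set T, closed A -> closed B ->
    (forall y, Z y -> A y \/ B y) ->
    (forall y, Z y -> A y) \/ (forall y, Z y -> B y).

Definition finite_krull_dim (Y : topologicalType) : Prop :=
  exists d : nat, ~ exists Z : nat -> set Y,
    (forall i, (i <= d)%N -> closed (Z i) /\ irreducible_set (Z i)) /\
    (forall i, (i < d)%N ->
       (forall y, Z i y -> Z i.+1 y) /\ exists y, Z i.+1 y /\ ~ Z i y).

(* A scheme has at most one morphism to the spectrum of [Z[1/2]], and has one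
   exactly when 2 is invertible on it. *)
Definition over_Z_half (Y : scheme) : Prop := is_unit (2%:R : \O_Y (topO Y)).

Definition closed_immersion (Z P : scheme) (i : morphism Z P) : Prop :=
  [/\ injective i,
      forall C : set Z, closed C -> closed (fun p : P => exists2 z, C z & i z = p)
    & forall (z : Z) (b : ostalk z), exists a, stalk_map i z a = b].

Definition is_product (Y P : scheme) (p1 p2 : morphism P Y) : Prop :=
  over_Z_half P /\
  forall (T : scheme) (a b : morphism T Y), over_Z_half T ->
    exists! c : morphism T P, comp_mor p1 c = a /\ comp_mor p2 c = b.

Definition separated_over_Z_half (Y : scheme) : Prop :=
  over_Z_half Y /\
  exists (P : scheme) (p1 p2 : morphism P Y) (delta : morphism Y P),
    [/\ is_product p1 p2, comp_mor p1 delta = id_mor Y,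
        comp_mor p2 delta = id_mor Y & closed_immersion delta].

Definition admissible (Y : scheme) : Prop :=
  [/\ regular_scheme Y, noetherian_scheme Y, separated_over_Z_half Y
    & finite_krull_dim Y].

Definition smooth (Y X : scheme) (f : morphism Y X) : Prop :=
  forall y : Y, exists (U : opens Y) (V : opens X) (h : U <=o f @^-1o V),
    [/\ U y, is_affine U, is_affine V
      & standard_smooth (rs_res h \o mor_sharp f V)].

Lemma top_pre (Y X : ringedSpace) (f : morphism Y X) :
  topO Y <=o f @^-1o (topO X).
Proof. by []. Qed.
Definition global_sharp (Y X : ringedSpace) (f : morphism Y X) :
    {rmorphism \O_X (topO X) -> \O_Y (topO Y)} :=
  rs_res (@top_pre Y X f) \o mor_sharp f (topO X).

Section Picard.
Variables (Y X : scheme) (pi : morphism Y X).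

(* Equality of the classes of two line bundles in [Pic(Y) / pi^* Pic(X)]. *)
Definition eq_picX (L L' : module Y) : Prop :=
  exists N : module X, line_bundle N /\ isomorphic L (L' ⊗ pull pi N).

(* Equality of these classes modulo 2. *)
Definition eq_picX_mod2 (L L' : module Y) : Prop :=
  exists K : module Y, line_bundle K /\ eq_picX L (L' ⊗ (K ⊗ K)).

Definition pic_pull_injective : Prop :=
  forall N N' : module X, line_bundle N -> line_bundle N' ->
    isomorphic (pull pi N) (pull pi N') -> isomorphic N N'.

Definition picX_no_2_torsion : Prop :=
  forall L : module Y, line_bundle L ->
    eq_picX (L ⊗ L) (structure_module Y) -> eq_picX L (structure_module Y).

Definition units_mod_squares_surjective : Prop :=
  forall u : \O_Y (topO Y), is_unit u ->
    exists (v : \O_X (topO X)) (w : \O_Y (topO Y)),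
      [/\ is_unit v, is_unit w & u = global_sharp pi v * w ^+ 2].

(* [S_X] is the full subcategory of the smooth [X]-schemes satisfying this. *)
Definition in_SX : Prop :=
  [/\ admissible Y, smooth pi, pic_pull_injective, picX_no_2_torsion
    & units_mod_squares_surjective].
End Picard.

Record prealignment (Y : ringedSpace) (L1 L2 : module Y) := Prealignment {
  al_mod : module Y;
  al_map : mod_hom (al_mod ⊗ al_mod ⊗ L1) L2 }.

Definition is_alignment (Y : ringedSpace) (L1 L2 : module Y)
    (A : prealignment L1 L2) : Prop :=
  line_bundle (al_mod A) /\ is_iso (al_map A).

Definition alignment_iso (Y : ringedSpace) (L1 L2 : module Y)
    (A A' : prealignment L1 L2) : Prop :=
  exists tau : mod_hom (al_mod A) (al_mod A'),
    is_iso tau /\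
    al_map A = hom_comp (al_map A')
                 (tensor_map (tensor_map tau tau) (hom_id L1)).

Definition pull_alignment (Y' Y : ringedSpace) (f : morphism Y' Y)
    (L1 L2 : module Y) (A : prealignment L1 L2) :
    prealignment (pull f L1) (pull f L2) :=
  let M := al_mod A in
  Prealignment (hom_comp (pull_map f (al_map A))
    (hom_comp (pull_tensor f (M ⊗ M) L1)
      (tensor_map (pull_tensor f M M) (hom_id (pull f L1))))).

(* Main.v *)
From Corelib Require Import -(notations) Setoid Morphisms.
From HB Require Import structures.
From mathcomp Require Import all_boot all_algebra.
From mathcomp Require Import boolp classical_sets topology_structure.
Require Import Defs.

Set Implicit Arguments.
Unset Strict Implicit.
Unset Printing Implicit Defensive.

Import GRing.Theory.
Local Open Scope ring_scope.

(** Write [q] for the structure map of [Ybar].  The hypothesis on the classes of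
    [L1] and [L2] says that [L1] is isomorphic to [L2 ⊗ K ⊗ K ⊗ pull piY N] for
    line bundles [K] on [Y] and [N] on [X].

    First the module of the alignment is found ([pic_descent]).  With [Mb] the
    module of [Abar] and [Q = Mb ⊗ pull f K], cancelling [pull f L2] shows that
    [Q ⊗ Q ⊗ pull q N] is trivial.  So [Q ⊗ Q] comes from [X]; since
    [Pic_X(Ybar)] has no 2-torsion, [Q] is isomorphic to [pull q P] for a line
    bundle [P] on [X]; and since [pull q] is injective on Picard groups,
    [P ⊗ P ⊗ N] is trivial on [X].  Then [M], the product of the dual of [K] and
    of [pull piY P], satisfies [M ⊗ M ⊗ L1 ≅ L2], and [pull f M] is isomorphic to
    [Mb].

    Choose isomorphisms [phi : M ⊗ M ⊗ L1 -> L2] and [tau : pull f M -> Mb].  The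
    pullback of [phi] and the map of [Abar], transported along [tau], are two
    isomorphisms between the same line bundles, so they differ by a global unit
    [u] on [Ybar] ([iso_unit]).  Write [u = v w^2] with [v] from [X].
    Multiplying [phi] by [v] and [tau] by the inverse of [w] makes the two maps
    equal.

    The properties of line bundles that this uses all come from local frames,
    that is, sections that trivialize a line bundle over an open set.  Tensor
    products, pullbacks and duals of frames are frames ([tensor_frame],
    [pull_frame], [dual_frame]), because a sheaf of locally generated functions
    has a frame as soon as one generator is a basis of every fibre and the
    others are locally multiples of it ([gen_sec_frame]).  Two line bundles whose
    frames have the same transition functions are isomorphic ([glue_iso]), and a
    map that sends frames to frames is an isomorphism ([iso_on_frames]).  Each
    law of the Picard group is then one comparison of transition functions. *)

(** * Frames *)

(** A trivialization of a line bundle is handled as a section, so that transition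
    functions are coefficients of one section on another. *)
Definition frame (Y : ringedSpace) (M : module Y) (U : opens Y) (e : M U) : Prop :=
  forall V (h : V <=o U), bijective (fun a : \O_Y V => a *: mres h e).

Lemma local_frame (Y : ringedSpace) (L : module Y) (y : Y) : line_bundle L ->
  exists U : opens Y, U y /\ exists e : L U, frame e.
Proof. by move=> bL; exact: bL. Qed.

Lemma sub_capO (T : topologicalType) (U V W : opens T) :
  W <=o U -> W <=o V -> W <=o capO U V.
Proof. by move=> h k y Wy; exact (conj (h y Wy) (k y Wy)). Qed.

Section Frames.
Variables (Y : ringedSpace) (M : module Y).

Lemma mres_irr (U V : opens Y) (h k : V <=o U) (m : M U) : mres h m = mres k m.
Proof. by congr mres; exact: Prop_irrelevance. Qed.

Lemma sheaf_sep (U : opens Y) (s t : M U) :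
  (forall y, U y -> exists (V : opens Y) (_ : V y) (h : V <=o U),
     mres h s = mres h t) -> s = t.
Proof.
move=> H; pose I := {V : opens Y | exists h : V <=o U, mres h s = mres h t}.
have hW (i : I) : sval i <=o U by case: i => V [].
apply: (proj1 (@m_sheaf _ M U I (fun i => sval i) hW _)) => [y Uy|[V HV]] /=.
  by have [V [Vy [h e]]] := H y Uy; exists (exist _ V (ex_intro _ h e)).
by have [h e] := HV; rewrite !(mres_irr _ h).
Qed.

Lemma frame_inj (U V : opens Y) (e : M U) (h : V <=o U) (a b : \O_Y V) :
  frame e -> a *: mres h e = b *: mres h e -> a = b.
Proof. by move=> fe; exact: (bij_inj (fe V h)). Qed.

Lemma frame_coord (U V : opens Y) (e : M U) (h : V <=o U) (m : M V) :
  frame e -> exists a, m = a *: mres h e.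
Proof. by move=> fe; have [g _ gK] := fe V h; exists (g m); rewrite gK. Qed.

Lemma frame_res (U V : opens Y) (h : V <=o U) (e : M U) :
  frame e -> frame (mres h e).
Proof.
move=> fe W k; have [g gK Kg] := fe W (sub_trans k h).
have E : mres k (mres h e) = mres (sub_trans k h) e by exact: mres_comp.
by rewrite E; exists g.
Qed.

Lemma frame_unit (U : opens Y) (e e' : M U) :
  frame e -> frame e' -> exists a b, [/\ e = a *: e', e' = b *: e & a * b = 1].
Proof.
move=> fe fe'.
have [a Ha] := frame_coord (@sub_refl _ U) e fe'.
have [b Hb] := frame_coord (@sub_refl _ U) e' fe.
rewrite mres_id in Ha; rewrite mres_id in Hb.
exists a, b; split=> //; apply: (frame_inj (h := @sub_refl _ U) fe).
by rewrite mres_id scale1r -scalerA -Hb.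
Qed.
End Frames.

Lemma frame1 (Y : ringedSpace) (U : opens Y) :
  frame (1 : structure_module Y U).
Proof.
move=> V h.
have E (a : \O_Y V) : a *: (mres h (1 : structure_module Y U)) = a.
  by rewrite [mres _ _](rmorph1 (rs_res h)) [LHS]mulr1.
by exists id => a /=; exact: E.
Qed.

(** * Gluing along frames *)

Definition covers (Y : ringedSpace) (I : Type) (U : I -> opens Y) : Prop :=
  forall y, exists i, U i y.

Section Glue.
Variables (Y : ringedSpace) (P P' : module Y) (I : Type) (U : I -> opens Y).
Variables (p : forall i, P (U i)) (p' : forall i, P' (U i)).
Hypothesis cov : covers U.
Hypothesis fp : forall i, frame (p i).
Hypothesis trans : forall i j V (h : V <=o U i) (k : V <=o U j),
  exists a, mres h (p i) = a *: mres k (p j) /\ mres h (p' i) = a *: mres k (p' j).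

(** The isomorphism to be glued sends [s] to the section with the same
    coordinates.  Phrasing this for every frame and every open set at once makes
    linearity and naturality consequences of uniqueness. *)
Definition same_coord (V : opens Y) (s : P V) (t : P' V) : Prop :=
  forall i W (h : W <=o V) (k : W <=o U i) a,
    mres h s = a *: mres k (p i) -> mres h t = a *: mres k (p' i).

Lemma same_coord_uniq V (s : P V) (t t' : P' V) :
  same_coord s t -> same_coord s t' -> t = t'.
Proof.
move=> H H'; apply: sheaf_sep => y Vy; have [i Uy] := cov y.
exists (capO V (U i)), (conj Vy Uy), (@capOl _ _ _).
have [a Ha] := frame_coord (@capOr _ V (U i)) (mres (@capOl _ V (U i)) s) (@fp i).
by rewrite (H _ _ _ _ _ Ha) (H' _ _ _ _ _ Ha).
Qed.

Lemma same_coord_ex V (s : P V) : exists t, same_coord s t.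
Proof.
have ex i : exists a : \O_Y (capO V (U i)),
    mres (@capOl _ V (U i)) s = a *: mres (@capOr _ V (U i)) (p i).
  exact: frame_coord.
pose a i := sval (cid (ex i)).
have Ha i : mres (@capOl _ V (U i)) s = a i *: mres (@capOr _ V (U i)) (p i).
  exact: svalP (cid (ex i)).
have Hs i W (h : W <=o capO V (U i)) (l : W <=o V) (k : W <=o U i) :
    mres l s = rs_res h (a i) *: mres k (p i).
  by rewrite -(mres_comp (@capOl _ V (U i)) h) Ha mresZ (mres_comp _ _ k).
have [t Ht] : exists t : P' V, forall i,
    mres (@capOl _ V (U i)) t = a i *: mres (@capOr _ V (U i)) (p' i).
  apply: (proj2 (@m_sheaf _ P' V I (fun i => capO V (U i))
    (fun i => @capOl _ V (U i)) _)).
    by move=> y Vy; have [i Uy] := cov y; exists i.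
  move=> i j W hi hj; rewrite !mresZ.
  have ki := sub_trans hi (@capOr _ V (U i)).
  have kj := sub_trans hj (@capOr _ V (U j)).
  rewrite (mres_comp _ _ ki) (mres_comp _ _ kj).
  (* The two candidates agree because both pairs of frames have the same
     transition function [c]. *)
  have [c [Hc ->]] := @trans i j W ki kj; rewrite scalerA; congr (_ *: _).
  have l := sub_trans hi (@capOl _ V (U i)).
  apply: (frame_inj (h := kj) (@fp j)).
  by rewrite -scalerA -Hc -(Hs i W hi l ki) -(Hs j W hj l kj).
exists t => i W h k b Hb.
have l := sub_capO h k.
rewrite -(mres_comp (@capOl _ V (U i)) l) Ht mresZ (mres_comp _ _ k).
by congr (_ *: _); apply: (frame_inj (h := k) (@fp i)); rewrite -Hb -(Hs i W l h k).
Qed.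

Definition glue_fun V (s : P V) : P' V := sval (cid (same_coord_ex s)).
Lemma glue_funP V (s : P V) : same_coord s (glue_fun s).
Proof. exact: svalP (cid (same_coord_ex s)). Qed.

Lemma glue_is_linear V : linear (@glue_fun V).
Proof.
move=> c s t; apply: (same_coord_uniq (@glue_funP _ _)) => i W h k a Ha.
have [b Hb] := frame_coord k (mres h s) (@fp i).
have [d Hd] := frame_coord k (mres h t) (@fp i).
rewrite mresD mresZ (glue_funP Hb) (glue_funP Hd) scalerA -scalerDl.
congr (_ *: _); apply: (frame_inj (h := k) (@fp i)).
by rewrite -Ha mresD mresZ Hb Hd scalerDl scalerA.
Qed.
HB.instance Definition _ V := GRing.isLinear.Build (\O_Y V) (P V) (P' V) *:%R
  (@glue_fun V) (@glue_is_linear V).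

Lemma glue_nat V W (h : W <=o V) (s : P V) :
  glue_fun (mres h s) = mres h (glue_fun s).
Proof.
apply: (same_coord_uniq (@glue_funP _ _)) => i Z k l a.
have hk := sub_trans k h.
by rewrite (mres_comp _ _ hk) (mres_comp _ _ hk); exact: glue_funP.
Qed.

Definition glue_hom : mod_hom P P' :=
  @ModHom Y P P' (fun V => @glue_fun V) glue_nat.

Lemma glue_hom_frame i : glue_hom (U i) (p i) = p' i.
Proof.
have := @glue_funP _ (p i) i (U i) (@sub_refl _ _) (@sub_refl _ _) 1.
by rewrite !scale1r !mres_id; exact.
Qed.
End Glue.

Lemma linear_eq (R : pzRingType) (E F : lmodType R) (g k : {linear E -> F}) :
  g =1 k -> g = k.
Proof.
move=> /funext; case: g k => g [[gD] [gZ]] [k [[kD] [kZ]]] /= e.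
case: k / e kD kZ => kD kZ.
by rewrite (Prop_irrelevance gD kD) (Prop_irrelevance gZ kZ).
Qed.

Lemma mod_hom_eq (Y : ringedSpace) (M N : module Y) (g k : mod_hom M N) :
  (forall U (m : M U), g U m = k U m) -> g = k.
Proof.
case: g k => g Hg [k Hk] /= e.
have {e} e : g = k.
  by apply: functional_extensionality_dep => U; apply: linear_eq; exact: e.
by case: k / e Hk => Hk; rewrite (Prop_irrelevance Hg Hk).
Qed.

Section Isomorphisms.
Variable Y : ringedSpace.

Lemma hom_eq_on_frames (P P' : module Y) (I : Type) (U : I -> opens Y)
    (p : forall i, P (U i)) (g k : mod_hom P P') :
  covers U -> (forall i, frame (p i)) ->
  (forall i, g (U i) (p i) = k (U i) (p i)) -> g = k.
Proof.
move=> cov fp e; apply: mod_hom_eq => V s; apply: sheaf_sep => y Vy.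
have [i Uy] := cov y.
exists (capO V (U i)), (conj Vy Uy), (@capOl _ _ _).
have [a Ha] := frame_coord (@capOr _ V (U i)) (mres (@capOl _ V (U i)) s) (@fp i).
by rewrite -!mh_nat Ha !linearZ /= !mh_nat e.
Qed.

(** A line bundle is determined by its transition functions. *)
Lemma glue_iso (P P' : module Y) (I : Type) (U : I -> opens Y)
    (p : forall i, P (U i)) (p' : forall i, P' (U i)) :
  covers U -> (forall i, frame (p i)) -> (forall i, frame (p' i)) ->
  (forall i j V (h : V <=o U i) (k : V <=o U j),
     exists a, mres h (p i) = a *: mres k (p j) /\
               mres h (p' i) = a *: mres k (p' j)) ->
  exists g : mod_hom P P', is_iso g /\ forall i, g (U i) (p i) = p' i.
Proof.
move=> cov fp fp' tr.
have tr' i j V (h : V <=o U i) (k : V <=o U j) :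
    exists a, mres h (p' i) = a *: mres k (p' j) /\ mres h (p i) = a *: mres k (p j).
  by have [a [? ?]] := tr i j V h k; exists a.
pose g := glue_hom cov fp tr; pose g' := glue_hom cov fp' tr'.
exists g; split; last by move=> i; exact: glue_hom_frame.
exists g'; split.
  apply: (hom_eq_on_frames cov fp) => i.
  apply: etrans (glue_hom_frame cov fp' tr' i).
  exact: (congr1 (fun x => g' (U i) x) (glue_hom_frame cov fp tr i)).
apply: (hom_eq_on_frames cov fp') => i.
apply: etrans (glue_hom_frame cov fp tr i).
exact: (congr1 (fun x => g (U i) x) (glue_hom_frame cov fp' tr' i)).
Qed.

Lemma iso_bij (P P' : module Y) (g : mod_hom P P') U : is_iso g -> bijective (g U).
Proof.
case=> k [/(congr1 (fun f : mod_hom _ _ => f U : _ -> _)) e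
          /(congr1 (fun f : mod_hom _ _ => f U : _ -> _)) e'].
by exists (k U) => x; [exact: (congr1 (@^~ x) e) | exact: (congr1 (@^~ x) e')].
Qed.

Lemma iso_frame (P P' : module Y) (g : mod_hom P P') U (e : P U) :
  is_iso g -> frame e -> frame (g U e).
Proof.
move=> ig fe V h.
have -> : (fun a => a *: mres h (g U e)) = g V \o (fun a => a *: mres h e).
  by apply: funext => a /=; rewrite linearZ mh_nat.
by apply: bij_comp; [exact: iso_bij | exact: fe].
Qed.

(** The images of the frames have the transition functions of the frames, so
    gluing gives an isomorphism which agrees with [g] on the frames. *)
Lemma iso_on_frames (P P' : module Y) (I : Type) (U : I -> opens Y)
    (p : forall i, P (U i)) (g : mod_hom P P') :
  covers U -> (forall i, frame (p i)) -> (forall i, frame (g (U i) (p i))) ->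
  is_iso g.
Proof.
move=> cov fp fg; have [|k [ik ek]] := glue_iso cov fp fg.
  move=> i j V h k; have [a Ha] := frame_coord k (mres h (p i)) (@fp j).
  by exists a; split=> //; rewrite -!mh_nat Ha linearZ.
by rewrite (hom_eq_on_frames (g := g) (k := k) cov fp) // => i; rewrite ek.
Qed.

Lemma is_iso_id (P : module Y) : is_iso (hom_id P).
Proof. by exists (hom_id P); split; apply: mod_hom_eq. Qed.

Lemma is_iso_comp (P P' P'' : module Y) (g : mod_hom P P') (k : mod_hom P' P'') :
  is_iso g -> is_iso k -> is_iso (hom_comp k g).
Proof.
move=> [g' [gK Kg]] [k' [kK Kk]].
have E (M N : module Y) (a b : mod_hom M N) : a = b -> forall U x, a U x = b U x.
  by move=> ->.
exists (hom_comp g' k'); split; apply: mod_hom_eq => U x.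
  apply: etrans (E _ _ _ _ gK U x).
  exact: (congr1 (fun z => g' U z) (E _ _ _ _ kK U (g U x))).
apply: etrans (E _ _ _ _ Kk U x).
exact: (congr1 (fun z => k U z) (E _ _ _ _ Kg U (k' U x))).
Qed.

Lemma isom_refl (P : module Y) : isomorphic P P.
Proof. by exists (hom_id P); exact: is_iso_id. Qed.
Lemma isom_sym (P P' : module Y) : isomorphic P P' -> isomorphic P' P.
Proof. by move=> [g [k [a b]]]; exists k, g. Qed.
Lemma isom_trans (P P' P'' : module Y) :
  isomorphic P P' -> isomorphic P' P'' -> isomorphic P P''.
Proof. by move=> [g ig] [k ik]; exists (hom_comp k g); exact: is_iso_comp. Qed.
End Isomorphisms.

(** * Frames and stalks *)

Section StalkFrame.
Variables (Y : ringedSpace).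

Lemma ogerm_eq_sub (y : Y) (U : opens Y) (Uy : U y) (a b : \O_Y U) :
  ogerm Uy a = ogerm Uy b -> exists (V : opens Y) (_ : V y) (h : V <=o U),
    rs_res h a = rs_res h b.
Proof.
move=> /germP [W [Wy [h [k e]]]]; exists W, Wy, h.
by rewrite (Prop_irrelevance k h) in e.
Qed.

Lemma ogerm_sep (U : opens Y) (a b : \O_Y U) :
  (forall y (Uy : U y), ogerm Uy a = ogerm Uy b) -> a = b.
Proof.
move=> H; apply: (sheaf_sep (M := structure_module Y)) => y Uy.
exact: (ogerm_eq_sub (H y Uy)).
Qed.

Section OneFrame.
Variables (M : module Y) (y : Y) (U : opens Y) (Uy : U y) (e : M U).
Hypothesis fe : frame e.

Lemma stalk_frame_ex (v : stalk y M) : exists c, v = c *: germ Uy e.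
Proof.
have [V [Vy [m ->]]] := germ_surj v.
have [a Ha] := frame_coord (@capOr _ V U) (mres (@capOl _ V U) m) fe.
exists (ogerm (conj Vy Uy : capO V U y) a).
rewrite -(germ_res Vy (conj Vy Uy : capO V U y) (@capOl _ V U) m) Ha germZ.
by rewrite germ_res.
Qed.

Lemma stalk_frame_inj (c d : ostalk y) :
  c *: germ Uy e = d *: germ Uy e -> c = d.
Proof.
have [V [Vy [a [b [-> ->]]]]] := germ_surj2 c d.
have Wy : capO V U y by split.
rewrite -(germ_res Uy Wy (@capOr _ V U) e).
have E (t : \O_Y V) : germ (M := structure_module Y) Vy t
    = ogerm Wy (rs_res (@capOl _ V U) t) by rewrite (ogerm_res Vy).
rewrite !E -!germZ => /germP [W [Wy' [h [k]]]].
rewrite (Prop_irrelevance k h) !mresZ (mres_comp _ _ (sub_trans h (@capOr _ V U))).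
move=> /(frame_inj fe) K.
by rewrite -(ogerm_res Wy Wy' h) K (ogerm_res Wy Wy' h).
Qed.

Definition stalk_coord (v : stalk y M) : ostalk y := sval (cid (stalk_frame_ex v)).
Lemma stalk_coordK v : v = stalk_coord v *: germ Uy e.
Proof. exact: svalP (cid (stalk_frame_ex v)). Qed.
Lemma stalk_coord_frame : stalk_coord (germ Uy e) = 1.
Proof. by apply: stalk_frame_inj; rewrite -stalk_coordK scale1r. Qed.
Lemma stalk_coordD v w : stalk_coord (v + w) = stalk_coord v + stalk_coord w.
Proof. by apply: stalk_frame_inj; rewrite scalerDl -!stalk_coordK. Qed.
Lemma stalk_coordZ a v : stalk_coord (a *: v) = a * stalk_coord v.
Proof. by apply: stalk_frame_inj; rewrite -scalerA -!stalk_coordK. Qed.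
End OneFrame.
End StalkFrame.

Lemma inj_surj_bij (A B : Type) (g : A -> B) :
  injective g -> (forall b, exists a, b = g a) -> bijective g.
Proof.
move=> gi gs; have gK b : g (sval (cid (gs b))) = b by rewrite -(svalP (cid (gs b))).
by exists (fun b => sval (cid (gs b))) => // a; apply: gi; rewrite gK.
Qed.

Section GeneratedFrame.
Variables (Y : ringedSpace) (G : generators Y) (U : opens Y) (i : gI G U).
Hypothesis i_free : forall y (Uy : U y) (a b : ostalk y),
  a *: gval i Uy = b *: gval i Uy -> a = b.
Hypothesis i_span : forall V (j : gI G V) y, V y -> U y ->
  exists (W : opens Y) (_ : W y) (h : W <=o V) (k : W <=o U) (a : \O_Y W),
    forall z (Wz : W z), gval j (h z Wz) = ogerm Wz a *: gval i (k z Wz).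

Lemma gcomb_span V (c : seq (\O_Y V * gI G V)) y : V y -> U y ->
  exists (W : opens Y) (_ : W y) (h : W <=o V) (k : W <=o U) (a : \O_Y W),
    forall z (Wz : W z), gcomb c (h z Wz) = ogerm Wz a *: gval i (k z Wz).
Proof.
move=> Vy Uy; elim: c => [|[b j] c [W [Wy [h [k [a Ha]]]]]].
  exists (capO V U), (conj Vy Uy), (@capOl _ _ _), (@capOr _ _ _), 0 => z Wz.
  by rewrite /gcomb big_nil [ogerm _ _]germ0 scale0r.
have [W' [Wy' [h' [k' [a' Ha']]]]] := @i_span V j y Vy Uy.
have l : capO W W' <=o V := sub_trans (@capOl _ W W') h.
have m : capO W W' <=o U := sub_trans (@capOl _ W W') k.
exists (capO W W'), (conj Wy Wy'), l, m, (rs_res l b * rs_res (@capOr _ W W') a'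
   + rs_res (@capOl _ W W') a) => z Wz.
have [Wz1 Wz2] := Wz.
rewrite /gcomb big_cons -/(gcomb c _) /=.
rewrite ogermD ogermM (ogerm_res Wz1) (ogerm_res Wz2) (ogerm_res (l z Wz)).
rewrite scalerDl -scalerA.
rewrite (Prop_irrelevance (l z Wz) (h z Wz1)).
rewrite (Prop_irrelevance (m z Wz) (k z Wz1)).
rewrite Ha; congr (_ *: _ + _).
rewrite (Prop_irrelevance (h z Wz1) (h' z Wz2)) Ha'.
by rewrite (Prop_irrelevance (k' z Wz2) (k z Wz1)).
Qed.

(** Near a point of [U] every section of [gmod G] is a multiple of the generator
    [i].  The coefficient is unique because [i] is free in each fibre, so these
    local coefficients glue to a section of the structure sheaf. *)
Lemma gen_sec_frame : frame (gen_sec i).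
Proof.
move=> V h; apply: inj_surj_bij => [a b e|s].
  apply: ogerm_sep => y Vy; apply: (@i_free _ (h y Vy)).
  exact: (congr1 (fun s : gsec G V => gfun s Vy) e).
have loc (v : {y | V y}) : exists W : opens Y, W (sval v) /\
    exists (l : W <=o V) (a : \O_Y W), mres l s = a *: mres (sub_trans l h) (gen_sec i).
  case: v => y Vy /=; have [V' [Vy' [l [c Hc]]]] := (@gfun_local _ _ _ s y Vy).
  have [W [Wy [l' [k [a Ha]]]]] := @gcomb_span _ c _ Vy' (h y Vy).
  exists W; split=> //; exists (sub_trans l' l), a; apply: gsec_eq => z Wz /=.
  rewrite (Prop_irrelevance (@sub_trans _ _ _ _ (sub_trans l' l) h z Wz) (k z Wz)).
  rewrite -Ha -Hc.
  by congr gfun; exact: Prop_irrelevance.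
pose W v := sval (cid (loc v)).
have loc' v := proj2 (svalP (cid (loc v))); rewrite -/(W _) in loc'.
pose l v := sval (cid (loc' v)).
have loc'' v := svalP (cid (loc' v)); rewrite -/(l _) in loc''.
pose a v := sval (cid (loc'' v)).
have Ha v : mres (l v) s = a v *: mres (sub_trans (l v) h) (gen_sec i)
  by exact: svalP (cid (loc'' v)).
have cov y : V y -> exists v, W v y.
  by move=> Vy; exists (exist _ y Vy); exact: (proj1 (svalP (cid (loc (exist _ y Vy))))).
have [t Ht] : exists t : \O_Y V, forall v, rs_res (l v) t = a v.
  apply: (proj2 (@m_sheaf _ (structure_module Y) V _ W l cov)) => v v' Z hi hj.
  apply: ogerm_sep => y Zy.
  apply: (@i_free _ (h y (l v y (hi y Zy)))).
  have E1 := congr1 (fun s : gsec G Z => gfun s Zy) (congr1 (mres hi) (Ha v)).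
  have E2 := congr1 (fun s : gsec G Z => gfun s Zy) (congr1 (mres hj) (Ha v')).
  move: E1 E2 => /=.
  rewrite (Prop_irrelevance (l v' y (hj y Zy)) (l v y (hi y Zy))) => ->.
  rewrite (Prop_irrelevance (@sub_trans _ _ _ _ (l v) h y (hi y Zy))
    (h y (l v y (hi y Zy)))).
  rewrite (Prop_irrelevance (@sub_trans _ _ _ _ (l v') h y (hj y Zy))
    (h y (l v y (hi y Zy)))).
  by rewrite -(ogerm_res (hi y Zy) Zy hi) -(ogerm_res (hj y Zy) Zy hj).
exists t; apply: gsec_eq => y Vy; have [v Wy] := cov y Vy.
have := congr1 (fun s : gsec G _ => gfun s Wy) (Ha v) => /=.
rewrite -Ht (ogerm_res (l v y Wy)) (Prop_irrelevance (l v y Wy) Vy) => ->.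
by congr (_ *: gval i _); exact: Prop_irrelevance.
Qed.
End GeneratedFrame.

(** * Tensor products, pullbacks and duals of frames *)

Section TensorFrame.
Variables (Y : ringedSpace) (M N : module Y).

Lemma mres_tensor_sec U V (h : V <=o U) (m : M U) (n : N U) :
  mres h (tensor_sec m n) = tensor_sec (mres h m) (mres h n).
Proof.
by apply: gsec_eq => y Vy; rewrite /= /tensor_val /= !(germ_res (h y Vy)).
Qed.

Lemma tensor_secZ U (a b : \O_Y U) (m : M U) (n : N U) :
  tensor_sec (a *: m) (b *: n) = (a * b) *: tensor_sec m n.
Proof.
apply: gsec_eq => y Uy; rewrite /= /tensor_val /= !germZ.
have H := tpure_balanced (idfun : {rmorphism ostalk y -> ostalk y})
  (stalk y M) (stalk y N).
by rewrite (balZl H) (balZr H) scalerA ogermM.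
Qed.

Lemma tensor_map_sec (M' N' : module Y) (g : mod_hom M M') (k : mod_hom N N')
    U (m : M U) (n : N U) :
  tensor_map g k U (tensor_sec m n) = tensor_sec (g U m) (k U n).
Proof.
apply: gsec_eq => y Uy; apply: etrans (tens_map_pure _ _ _ _ _) _.
by congr tpure; exact: stalk_hom_germ.
Qed.

Lemma tensor_frame U (m : M U) (n : N U) :
  frame m -> frame n -> frame (tensor_sec m n).
Proof.
move=> fm fn; apply: gen_sec_frame => [y Uy a b|V [m' n'] y Vy Uy] /=.
  (* The product of the coordinates is a linear form on the tensor product
     which is 1 on the product of the frames. *)
  pose c (p : stalk y M) (q : stalk y N) : (ostalk y)^o :=
    stalk_coord Uy fm p * stalk_coord Uy fn q.
  have Hc : balanced (idfun : {rmorphism ostalk y -> ostalk y}) c.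
    split=> *; rewrite /c.
    - by rewrite stalk_coordD mulrDl.
    - by rewrite stalk_coordD mulrDr.
    - by rewrite stalk_coordZ -mulrA.
    - by rewrite stalk_coordZ mulrCA.
  move=> /(congr1 (tens_lift Hc)).
  rewrite !linearZ /= !(tens_liftE Hc) /c /=.
  by rewrite /= !stalk_coord_frame /GRing.scale /= !mulr1.
have [a Ha] := frame_coord (@capOr _ V U) (mres (@capOl _ V U) m') fm.
have [b Hb] := frame_coord (@capOr _ V U) (mres (@capOl _ V U) n') fn.
exists (capO V U), (conj Vy Uy), (@capOl _ V U), (@capOr _ V U), (a * b) => z Wz.
have := congr1 (fun s : gsec (tensor_generators M N) _ => gfun s Wz)
  (tensor_secZ a b (mres (@capOr _ V U) m) (mres (@capOr _ V U) n)).
rewrite -Ha -Hb /= /tensor_val /= !(germ_res (@capOr _ V U z Wz)).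
by rewrite !(germ_res (@capOl _ V U z Wz)).
Qed.
End TensorFrame.

Section PullFrame.
Variables (Y X : ringedSpace) (f : morphism Y X) (L : module X).

Lemma pull_secZ U (a : \O_X U) (l : L U) :
  pull_sec f (a *: l) = mor_sharp f U a *: pull_sec f l.
Proof.
apply: gsec_eq => y Uy; rewrite /= /pull_val /= germZ.
apply: etrans (balZl (tpure_balanced (stalk_map f y) _ _) _ _ _) _.
congr (_ *: _); rewrite (Prop_irrelevance (sub_refl _) Uy).
exact: (stalk_map_germ (f := f) (y := y) Uy a).
Qed.

Lemma mres_pull_sec U V (h : V <=o U) (k : f @^-1o V <=o f @^-1o U) (l : L U) :
  mres k (pull_sec f l) = pull_sec f (mres h l).
Proof.
apply: gsec_eq => y Vy; rewrite /= /pull_val /=.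
congr tpure; rewrite (germ_res (k y Vy : U (f y))).
by congr (germ _ _); exact: Prop_irrelevance.
Qed.

Lemma pull_sec_trans U U' V W (h : V <=o U) (k : V <=o U') (l : L U) (l' : L U')
    (a : \O_X V) (w : W <=o f @^-1o V) (h' : W <=o f @^-1o U) (k' : W <=o f @^-1o U') :
  mres h l = a *: mres k l' ->
  mres h' (pull_sec f l) = rs_res w (mor_sharp f V a) *: mres k' (pull_sec f l').
Proof.
move=> e; have h1 : f @^-1o V <=o f @^-1o U by move=> y /h.
have k1 : f @^-1o V <=o f @^-1o U' by move=> y /k.
rewrite -(mres_comp h1 w) -(mres_comp k1 w) !mres_pull_sec e pull_secZ.
by rewrite mresZ.
Qed.

Lemma pull_map_sec (L' : module X) (g : mod_hom L L') U (l : L U) :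
  pull_map f g (f @^-1o U) (pull_sec f l) = pull_sec f (g U l).
Proof.
apply: gsec_eq => y Uy; apply: etrans (tens_map_pure _ _ _ _ _) _.
by congr tpure; exact: stalk_hom_germ.
Qed.

Lemma pull_frame U (l : L U) : frame l -> frame (pull_sec f l).
Proof.
move=> fl; apply: gen_sec_frame => [y Uy a b|V j y Vy Uy] /=.
  (* The coordinate along the frame extends to a linear form on the base change
     which is 1 on the image of the frame. *)
  pose c (p : stalk (f y) L) (b : (ostalk y)^o) : (ostalk y)^o :=
    stalk_map f y (stalk_coord (Uy : U (f y)) fl p) * b.
  have Hc : balanced (stalk_map f y) c.
    split=> *; rewrite /c.
    - by rewrite stalk_coordD rmorphD mulrDl.
    - by rewrite mulrDr.
    - by rewrite stalk_coordZ rmorphM -mulrA.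
    - by rewrite /GRing.scale /= mulrCA.
  have T (d : ostalk y) :
      tens_lift Hc (d *: pull_val (PullIndex (@sub_refl _ (f @^-1o U)) l) Uy) = d.
    apply: etrans (linearZ_LR (tens_lift Hc) _ _) _.
    apply: etrans (congr1 ( *:%R d) (tens_liftE Hc _ _)) _; rewrite /c /=.
    have C (Uy' : U (f y)) : stalk_coord (Uy : U (f y)) fl (germ Uy' l) = 1.
      by rewrite (Prop_irrelevance Uy' Uy) stalk_coord_frame.
    by rewrite C [stalk_map _ _ _]rmorph1 mulr1 [LHS]mulr1.
  by move=> E; rewrite -[a]T -[b]T [in LHS]E.
case: j => V' s l'.
have [a Ha] := frame_coord (@capOr _ V' U) (mres (@capOl _ V' U) l') fl.
have w : capO V (f @^-1o U) <=o f @^-1o (capO V' U).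
  by move=> z [Vz Uz]; split=> //; exact: s.
exists (capO V (f @^-1o U)), (conj Vy Uy), (@capOl _ V _), (@capOr _ V _).
exists (rs_res w (mor_sharp f _ a)) => z Wz /=.
have h' : capO V (f @^-1o U) <=o f @^-1o V' by move=> ? [/s].
have := pull_sec_trans w h' (@capOr _ V (f @^-1o U)) Ha.
move/(congr1 (fun s : gsec (pull_generators f L) _ => gfun s Wz)) => /= <-.
rewrite /pull_val /=; congr (tpure _ (germ _ _) _); exact: Prop_irrelevance.
Qed.
End PullFrame.

(** The dual is built without sheaves of linear forms.  A basis [base_germ y] of
    every stalk is chosen; it identifies the dual of the stalk with [ostalk y].
    The section dual to a frame [e] takes the value 1 on [e], so it is the
    coefficient of [base_germ y] on [germ e], and these functions generate the
    dual. *)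
Section Dual.
Variables (Y : ringedSpace) (L : module Y) (bL : line_bundle L).

Lemma germ_frame_ex (y : Y) : exists g : stalk y L,
  forall v, exists c, v = c *: g.
Proof.
have [U [Uy [e fe]]] := local_frame y bL; exists (germ Uy e) => v.
exact: stalk_frame_ex.
Qed.
Definition base_germ (y : Y) : stalk y L := sval (cid (germ_frame_ex y)).

Record dual_index (U : opens Y) := DualIndex { di_sec : L U; di_frame : frame di_sec }.
Definition dual_val (U : opens Y) (e : dual_index U) (y : Y) (Uy : U y) :
  ((ostalk y)^o : lmodType (ostalk y)) := stalk_coord Uy (di_frame e) (base_germ y).

Lemma dual_val_res U V (h : V <=o U) (e : dual_index U) : exists e' : dual_index V,
  forall y (Vy : V y), dual_val e' Vy = dual_val e (h y Vy).
Proof.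
exists (DualIndex (frame_res h (di_frame e))) => y Vy.
apply: (stalk_frame_inj (Uy := h y Vy) (di_frame e)).
apply: etrans _ (stalk_coordK (h y Vy) (di_frame e) (base_germ y)).
rewrite -(germ_res (h y Vy) Vy h).
exact (esym (stalk_coordK Vy (frame_res h (di_frame e)) (base_germ y))).
Qed.
Definition dual_generators : generators Y := Generators dual_val_res.
Definition dual : module Y := gmod dual_generators.
Definition dual_sec U (e : L U) (fe : frame e) : dual U :=
  @gen_sec Y dual_generators U (DualIndex fe).

Lemma dual_val_unit U (e : dual_index U) y (Uy : U y) :
  exists c, c * dual_val e Uy = 1.
Proof.
have [c Hc] := svalP (cid (germ_frame_ex y)) (germ Uy (di_sec e)).
exists c; apply: (stalk_frame_inj (Uy := Uy) (di_frame e)).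
by rewrite -scalerA -stalk_coordK scale1r.
Qed.

Lemma dual_sec_trans U (e e' : L U) (fe : frame e) (fe' : frame e') (a b : \O_Y U) :
  e = a *: e' -> a * b = 1 -> dual_sec fe = b *: dual_sec fe'.
Proof.
move=> E ab; apply: gsec_eq => y Uy /=.
apply: (stalk_frame_inj (Uy := Uy) fe).
apply: etrans (esym (stalk_coordK Uy fe (base_germ y))) _.
rewrite {1}E germZ; apply: etrans (stalk_coordK Uy fe' (base_germ y)) _.
rewrite scalerA; congr (_ *: _).
have {}ab : ogerm Uy b * ogerm Uy a = 1 by rewrite -ogermM mulrC ab ogerm1.
by apply: esym; rewrite -[RHS]mul1r -ab mulrAC.
Qed.

Lemma mres_dual_sec U V (h : V <=o U) (e : L U) (fe : frame e) (fe' : frame (mres h e)) :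
  mres h (dual_sec fe) = dual_sec fe'.
Proof.
apply: gsec_eq => y Vy /=.
apply: (stalk_frame_inj (Uy := h y Vy) fe).
apply: etrans (esym (stalk_coordK (h y Vy) fe (base_germ y))) _.
rewrite -(germ_res (h y Vy) Vy h).
exact: (stalk_coordK Vy fe' (base_germ y)).
Qed.

Lemma dual_frame U (e : L U) (fe : frame e) : frame (dual_sec fe).
Proof.
apply: gen_sec_frame => [y Uy a b|V [e' fe'] y Vy Uy] /=.
  have [c Hc] := dual_val_unit (DualIndex fe) Uy.
  move=> /(congr1 (fun t => c * t)) /=; rewrite /GRing.scale /=.
  by rewrite !(mulrCA c) !Hc !mulr1.
have f1 := frame_res (@capOl _ V U) fe'; have f2 := frame_res (@capOr _ V U) fe.
have [a [b [E _ ab]]] := frame_unit f1 f2.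
exists (capO V U), (conj Vy Uy), (@capOl _ V U), (@capOr _ V U), b => z Wz.
have := congr1 (fun s : gsec dual_generators _ => gfun s Wz)
  (dual_sec_trans f1 f2 E ab).
by rewrite -!mres_dual_sec.
Qed.
End Dual.

(** * Laws of the tensor product, the dual and the pullback *)

Section LocalFrames.
Variable Y : ringedSpace.

(** These records index the covers along which isomorphisms are glued.  Since an
    index carries the frames themselves, no frames have to be chosen. *)
Record frames1 (M : module Y) := Frames1 {
  f1_open : opens Y; f1_sec : M f1_open; f1_secP : frame f1_sec }.
Record frames2 (M N : module Y) := Frames2 {
  f2_open : opens Y; f2_l : M f2_open; f2_r : N f2_open;
  f2_lP : frame f2_l; f2_rP : frame f2_r }.
Record frames3 (M N P : module Y) := Frames3 {
  f3_pair : frames2 M N; f3_sec : P (f2_open f3_pair); f3_secP : frame f3_sec }.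

Lemma frames1_cover (M : module Y) : line_bundle M ->
  covers (fun i : frames1 M => f1_open i).
Proof.
by move=> bM y; have [U [Uy [e fe]]] := local_frame y bM; exists (Frames1 fe).
Qed.

Lemma frames2_cover (M N : module Y) : line_bundle M -> line_bundle N ->
  covers (fun i : frames2 M N => f2_open i).
Proof.
move=> bM bN y; have [U [Uy [m fm]]] := local_frame y bM.
have [V [Vy [n fn]]] := local_frame y bN.
by exists (Frames2 (frame_res (@capOl _ U V) fm) (frame_res (@capOr _ U V) fn)).
Qed.

Lemma frames3_cover (M N P : module Y) :
  line_bundle M -> line_bundle N -> line_bundle P ->
  covers (fun i : frames3 M N P => f2_open (f3_pair i)).
Proof.
move=> bM bN bP y; have [[U m n fm fn] /= Uy] := frames2_cover bM bN y.
have [V [Vy [p fp]]] := local_frame y bP.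
pose i := Frames2 (frame_res (@capOl _ U V) fm) (frame_res (@capOl _ U V) fn).
by exists (@Frames3 M N P i _ (frame_res (@capOr _ U V) fp)).
Qed.

Lemma cover_line_bundle (P : module Y) (I : Type) (U : I -> opens Y)
    (p : forall i, P (U i)) : covers U -> (forall i, frame (p i)) -> line_bundle P.
Proof.
move=> cov fp y; have [i Uy] := cov y.
by exists (U i); split=> //; exists (p i); exact: fp.
Qed.

Lemma mres_tensor_trans (M N : module Y) (U U' V : opens Y) (h : V <=o U) (k : V <=o U')
    (m : M U) (m' : M U') (n : N U) (n' : N U') (a b : \O_Y V) :
  mres h m = a *: mres k m' -> mres h n = b *: mres k n' ->
  mres h (tensor_sec m n) = (a * b) *: mres k (tensor_sec m' n').
Proof. by move=> Ha Hb; rewrite !mres_tensor_sec Ha Hb tensor_secZ. Qed.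

Lemma line_bundle_O : line_bundle (structure_module Y).
Proof.
move=> y; exists (topO Y); split=> //.
by exists (1 : structure_module Y _); exact: frame1.
Qed.

Lemma line_bundle_tensor (M N : module Y) :
  line_bundle M -> line_bundle N -> line_bundle (M ⊗ N).
Proof.
move=> bM bN; apply: (cover_line_bundle (frames2_cover bM bN)
  (p := fun i => tensor_sec (f2_l i) (f2_r i))) => -[] *; exact: tensor_frame.
Qed.

Lemma line_bundle_dual (M : module Y) (bM : line_bundle M) : line_bundle (dual bM).
Proof.
move=> y; have [U [Uy [e fe]]] := local_frame y bM.
by exists U; split=> //; exists (dual_sec bM fe); exact: dual_frame.
Qed.

Lemma tensor_comm (M N : module Y) : line_bundle M -> line_bundle N ->
  isomorphic (M ⊗ N) (N ⊗ M).
Proof.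
move=> bM bN; have [|i|i|i j V h k|g [ig _]] := @glue_iso Y (M ⊗ N) (N ⊗ M) _ _
  (fun i : frames2 M N => tensor_sec (f2_l i) (f2_r i))
  (fun i => tensor_sec (f2_r i) (f2_l i)).
- exact: frames2_cover.
- by case: i => *; exact: tensor_frame.
- by case: i => *; exact: tensor_frame.
- have [a Ha] := frame_coord k (mres h (f2_l i)) (@f2_lP _ _ j).
  have [b Hb] := frame_coord k (mres h (f2_r i)) (@f2_rP _ _ j).
  exists (a * b); split; first exact: mres_tensor_trans.
  by rewrite mulrC; exact: mres_tensor_trans.
by exists g.
Qed.

Lemma tensor_assoc (M N P : module Y) :
  line_bundle M -> line_bundle N -> line_bundle P ->
  isomorphic (M ⊗ (N ⊗ P)) (M ⊗ N ⊗ P).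
Proof.
move=> bM bN bP.
have [|i|i|i j V h k|g [ig _]] := @glue_iso Y (M ⊗ (N ⊗ P)) (M ⊗ N ⊗ P) _ _
  (fun i : frames3 M N P => tensor_sec (f2_l (f3_pair i))
     (tensor_sec (f2_r (f3_pair i)) (f3_sec i)))
  (fun i => tensor_sec (tensor_sec (f2_l (f3_pair i)) (f2_r (f3_pair i)))
     (f3_sec i)).
- exact: frames3_cover.
- by case: i => -[] *; do 2?apply: tensor_frame.
- by case: i => -[] *; do 2?apply: tensor_frame.
- have [a Ha] := frame_coord k (mres h (f2_l (f3_pair i))) (@f2_lP _ _ (f3_pair j)).
  have [b Hb] := frame_coord k (mres h (f2_r (f3_pair i))) (@f2_rP _ _ (f3_pair j)).
  have [c Hc] := frame_coord k (mres h (f3_sec i)) (@f3_secP _ _ _ j).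
  exists (a * b * c); split; first rewrite -mulrA; do 2?apply: mres_tensor_trans => //.
by exists g.
Qed.

Lemma tensor_unit (L : module Y) : line_bundle L ->
  isomorphic (structure_module Y ⊗ L) L.
Proof.
move=> bL; have [|i|i|i j V h k|g [ig _]] := @glue_iso Y (structure_module Y ⊗ L) L _ _
  (fun i : frames1 L => tensor_sec (1 : structure_module Y _) (f1_sec i))
  (fun i => f1_sec i).
- exact: frames1_cover.
- by case: i => *; apply: tensor_frame => //; exact: frame1.
- by case: i.
- have [a Ha] := frame_coord k (mres h (f1_sec i)) (@f1_secP _ j).
  exists a; split=> //; rewrite -[a]mul1r; apply: mres_tensor_trans => //.
  by rewrite scale1r; apply: etrans (rmorph1 (rs_res h)) (esym (rmorph1 (rs_res k))).
by exists g.
Qed.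

(** A change of frame by [a] changes the dual frame by the inverse of [a], so the
    products of the frames with their duals have trivial transition functions. *)
Lemma tensor_dual (L : module Y) (bL : line_bundle L) :
  isomorphic (dual bL ⊗ L) (structure_module Y).
Proof.
have [|i|i|i j V h k|g [ig _]] := @glue_iso Y (dual bL ⊗ L) (structure_module Y) _ _
  (fun i : frames1 L => tensor_sec (dual_sec bL (@f1_secP _ i)) (f1_sec i)) (fun i => 1).
- exact: frames1_cover.
- by case: i => *; apply: tensor_frame => //; exact: dual_frame.
- exact: frame1.
- have fi := frame_res h (@f1_secP _ i); have fj := frame_res k (@f1_secP _ j).
  have [a [b [Ha _ ab]]] := frame_unit fi fj.
  exists 1; split; last first.
    by rewrite scale1r; apply: etrans (rmorph1 (rs_res h)) (esym (rmorph1 (rs_res k))).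
  rewrite -ab mulrC; apply: mres_tensor_trans => //.
  by rewrite (mres_dual_sec bL _ fi) (mres_dual_sec bL _ fj); exact: dual_sec_trans ab.
by exists g.
Qed.

Lemma tensor_map_iso (M M' N N' : module Y) (g : mod_hom M M') (k : mod_hom N N') :
  line_bundle M -> line_bundle N -> is_iso g -> is_iso k -> is_iso (tensor_map g k).
Proof.
move=> bM bN ig ik; apply: (iso_on_frames (frames2_cover bM bN)
  (p := fun i => tensor_sec (f2_l i) (f2_r i))) => -[U m n fm fn] /=.
  exact: tensor_frame.
by rewrite tensor_map_sec; apply: tensor_frame; exact: iso_frame.
Qed.
End LocalFrames.

Section PullIsos.
Variables (Y X : ringedSpace) (f : morphism Y X).

Lemma pull_cover (I : Type) (U : I -> opens X) :
  covers U -> covers (fun i => f @^-1o (U i)).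
Proof. by move=> cov y; have [i Ui] := cov (f y); exists i. Qed.

Lemma line_bundle_pull (L : module X) : line_bundle L -> line_bundle (pull f L).
Proof.
move=> bL y; have [U [Uy [e fe]]] := local_frame (f y) bL.
by exists (f @^-1o U); split=> //; exists (pull_sec f e); exact: pull_frame.
Qed.

Lemma pull_map_iso (M N : module X) (g : mod_hom M N) :
  line_bundle M -> is_iso g -> is_iso (pull_map f g).
Proof.
move=> bM ig; apply: (iso_on_frames (pull_cover (frames1_cover bM))
  (p := fun i => pull_sec f (f1_sec i))) => -[U m fm] /=.
  exact: pull_frame.
by rewrite pull_map_sec; apply: pull_frame; exact: iso_frame.
Qed.

Lemma pull_tensor_iso (M N : module X) :
  line_bundle M -> line_bundle N -> is_iso (pull_tensor f M N).
Proof.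
move=> bM bN; apply: (iso_on_frames (pull_cover (frames2_cover bM bN))
  (p := fun i => tensor_sec (pull_sec f (f2_l i)) (pull_sec f (f2_r i)))).
  by case=> U m n fm fn; apply: tensor_frame; exact: pull_frame.
case=> U m n fm fn /=.
by rewrite pull_tensor_sec; apply: pull_frame; exact: tensor_frame.
Qed.

Lemma pull_O : isomorphic (pull f (structure_module X)) (structure_module Y).
Proof.
have [|i|i|i j V h k|g [ig _]] := @glue_iso Y (pull f (structure_module X))
  (structure_module Y) unit (fun _ => f @^-1o (topO X))
  (fun _ => pull_sec f (1 : structure_module X _)) (fun _ => 1).
- by move=> y; exists tt.
- by apply: pull_frame; exact: frame1.
- exact: frame1.
- by exists 1; rewrite !scale1r; split; exact: mres_irr.
by exists g.
Qed.
End PullIsos.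

Lemma pull_comp (Z Y X : ringedSpace) (g : morphism Y X) (f : morphism Z Y)
    (L : module X) : line_bundle L ->
  isomorphic (pull f (pull g L)) (pull (comp_mor g f) L).
Proof.
move=> bL.
have comp_pre_le (i : frames1 L) :
    f @^-1o (g @^-1o f1_open i) <=o comp_mor g f @^-1o f1_open i by [].
have [|i|i|i j V h k|t [it _]] := @glue_iso Z (pull f (pull g L))
  (pull (comp_mor g f) L) _ _
  (fun i : frames1 L => pull_sec f (pull_sec g (f1_sec i)))
  (fun i => mres (@comp_pre_le i) (pull_sec (comp_mor g f) (f1_sec i))).
- by do 2!apply: pull_cover; exact: frames1_cover.
- by case: i => *; do 2!apply: pull_frame.
- by case: i => *; apply: frame_res; apply: pull_frame.
- have [a Ha] := frame_coord (@capOr _ (f1_open i) (f1_open j))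
    (mres (@capOl _ _ _) (f1_sec i)) (@f1_secP _ _ j).
  (* The transition functions on both sides are the pullback of the transition
     function [a] on the base. *)
  have w : V <=o f @^-1o (g @^-1o (capO (f1_open i) (f1_open j))).
    by move=> z Vz; exact (conj (h z Vz) (k z Vz)).
  have w' : V <=o comp_mor g f @^-1o (capO (f1_open i) (f1_open j)) by exact: w.
  exists (rs_res w' (mor_sharp (comp_mor g f) _ a)); split; last first.
    have h' : V <=o comp_mor g f @^-1o (f1_open i) by exact: h.
    have k' : V <=o comp_mor g f @^-1o (f1_open j) by exact: k.
    by rewrite (mres_comp _ _ h') (mres_comp _ _ k'); exact: pull_sec_trans Ha.
  have h1 : g @^-1o (capO (f1_open i) (f1_open j)) <=o g @^-1o (f1_open i).
    by move=> y [].
  have k1 : g @^-1o (capO (f1_open i) (f1_open j)) <=o g @^-1o (f1_open j).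
    by move=> y [].
  have := pull_sec_trans (@sub_refl _ _) h1 k1 Ha; rewrite rs_res_id.
  move/(pull_sec_trans w h k) => ->; congr (_ *: _).
  by rewrite /= (rs_res_comp _ _ w).
by exists t.
Qed.

(** * Units and isomorphisms of line bundles *)

Section Scaling.
Variable Y : ringedSpace.
Local Notation resT := (rs_res (@sub_top _ _)).

Definition scale_fun (M N : module Y) (u : \O_Y (topO Y)) (g : mod_hom M N)
  (U : opens Y) (m : M U) : N U := resT u *: g U m.
Lemma scale_fun_is_linear (M N : module Y) u (g : mod_hom M N) U :
  linear (@scale_fun M N u g U).
Proof.
by move=> a m n; rewrite /scale_fun linearP scalerDr !scalerA mulrC.
Qed.
HB.instance Definition _ (M N : module Y) u (g : mod_hom M N) U :=
  GRing.isLinear.Build (\O_Y U) (M U) (N U) *:%R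
    (@scale_fun M N u g U) (@scale_fun_is_linear M N u g U).
Lemma scale_nat (M N : module Y) u (g : mod_hom M N) U V (h : V <=o U) m :
  scale_fun u g (mres h m) = mres h (scale_fun u g m).
Proof. by rewrite /scale_fun mresZ (rs_res_comp _ _ (@sub_top _ V)) mh_nat. Qed.
Definition scale_hom (M N : module Y) u (g : mod_hom M N) : mod_hom M N :=
  @ModHom Y M N (fun U => @scale_fun M N u g U) (scale_nat u g).

Lemma scale_hom1 (M N : module Y) (g : mod_hom M N) : scale_hom 1 g = g.
Proof. by apply: mod_hom_eq => U m; rewrite /= /scale_fun rmorph1 scale1r. Qed.
Lemma scale_homM (M N : module Y) u v (g : mod_hom M N) :
  scale_hom u (scale_hom v g) = scale_hom (u * v) g.
Proof. by apply: mod_hom_eq => U m; rewrite /= /scale_fun rmorphM scalerA. Qed.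
Lemma comp_scalel (M N P : module Y) u (g : mod_hom N P) (k : mod_hom M N) :
  hom_comp (scale_hom u g) k = scale_hom u (hom_comp g k).
Proof. exact: mod_hom_eq. Qed.
Lemma comp_scaler (M N P : module Y) u (g : mod_hom N P) (k : mod_hom M N) :
  hom_comp g (scale_hom u k) = scale_hom u (hom_comp g k).
Proof. by apply: mod_hom_eq => U m; rewrite /= /scale_fun linearZ. Qed.

Lemma scale_iso (M N : module Y) u (g : mod_hom M N) :
  is_unit u -> is_iso g -> is_iso (scale_hom u g).
Proof.
move=> [v uv] [k [gK Kg]]; exists (scale_hom v k).
rewrite !comp_scalel !comp_scaler gK Kg !scale_homM.
by rewrite uv mulrC uv !scale_hom1.
Qed.

Lemma tensor_map_scale (M M' N N' : module Y) u v (g : mod_hom M M') (k : mod_hom N N') :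
  line_bundle M -> line_bundle N ->
  tensor_map (scale_hom u g) (scale_hom v k) = scale_hom (u * v) (tensor_map g k).
Proof.
move=> bM bN; apply: (hom_eq_on_frames (frames2_cover bM bN)
  (p := fun i => tensor_sec (f2_l i) (f2_r i))) => -[U m n fm fn].
  exact: tensor_frame.
rewrite [RHS]/= /scale_fun !tensor_map_sec rmorphM; exact: tensor_secZ.
Qed.

(** Over an open set with a frame [e], [k e] has a coordinate along the frame
    [g e]; this coordinate does not depend on [e], since changing [e] changes
    [k e] and [g e] by the same factor.  So the coordinates glue to [u]. *)
Lemma iso_proportional (P P' : module Y) (g k : mod_hom P P') :
  line_bundle P -> is_iso g -> exists u, k = scale_hom u g.
Proof.
move=> bP ig; pose I := frames1 P; pose p (i : I) := f1_sec i.
have fp i : frame (p i) by case: i.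
have fg i : frame (g _ (p i)) by exact: iso_frame.
have ex i : exists a, k _ (p i) = a *: g _ (p i).
  have [a Ha] := frame_coord (@sub_refl _ _) (k _ (p i)) (@fg i).
  by exists a; rewrite mres_id in Ha.
pose a i := sval (cid (ex i)).
have Ha i : k _ (p i) = a i *: g _ (p i) by exact: svalP (cid (ex i)).
have [u Hu] : exists u : \O_Y (topO Y), forall i : I, rs_res (@sub_top _ _) u = a i.
  apply: (proj2 (@m_sheaf _ (structure_module Y) (topO Y) I _
    (fun i => @sub_top _ (f1_open i)) _) a).
    by move=> y _; have [i Uy] := frames1_cover bP y; exists i.
  move=> i j V hi hj; apply: (frame_inj (h := hi) (@fg i)).
  rewrite -[LHS]mresZ -Ha -mh_nat.
  have [c Hc] := frame_coord hj (mres hi (p i)) (@fp j).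
  rewrite Hc linearZ /= mh_nat Ha -[in RHS]mh_nat Hc linearZ /= mh_nat mresZ.
  by rewrite !scalerA mulrC.
exists u; apply: (hom_eq_on_frames (frames1_cover bP) fp) => i.
by rewrite /= /scale_fun Hu -Ha.
Qed.

(** The factors in the two directions are inverse to each other. *)
Lemma iso_unit (P P' : module Y) (g k : mod_hom P P') :
  line_bundle P -> is_iso g -> is_iso k -> exists u, is_unit u /\ k = scale_hom u g.
Proof.
move=> bP ig ik; have [u Hu] := iso_proportional k bP ig.
have [v Hv] := iso_proportional g bP ik.
exists u; split=> //; exists v; apply: (sheaf_sep (M := structure_module Y)) => y _.
have [[U m fm] /= Uy] := frames1_cover bP y.
exists U, Uy, (@sub_top _ _).
have fg : frame (g U m) by exact: iso_frame.
apply: (frame_inj (h := @sub_refl _ U) fg); rewrite mres_id.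
rewrite /mres /= /Ores rmorph1 scale1r.
have E : scale_hom (v * u) g = g by rewrite -scale_homM -Hu.
by rewrite -[in RHS]E /= /scale_fun mulrC.
Qed.
End Scaling.

Lemma pull_map_scale (Y X : ringedSpace) (f : morphism Y X) (M N : module X) u
    (g : mod_hom M N) : line_bundle M ->
  pull_map f (scale_hom u g) = scale_hom (global_sharp f u) (pull_map f g).
Proof.
move=> bM; apply: (hom_eq_on_frames (pull_cover f (frames1_cover bM))
  (p := fun i => pull_sec f (f1_sec i))) => -[U m fm].
  exact: pull_frame.
rewrite [RHS]/= /scale_fun !pull_map_sec [scale_hom _ _ _ _]/= /scale_fun pull_secZ.
congr (_ *: _); have k : f @^-1o U <=o f @^-1o (topO X) by [].
by rewrite (mor_nat _ k) /= (rs_res_comp _ _ k).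
Qed.

Lemma unit_morph (R S : comPzRingType) (g : {rmorphism R -> S}) (u : R) :
  is_unit u -> is_unit (g u).
Proof. by move=> [v uv]; exists (g v); rewrite -rmorphM uv rmorph1. Qed.

Lemma global_sharp_comp (Z Y X : ringedSpace) (g : morphism Y X) (f : morphism Z Y) u :
  global_sharp (comp_mor g f) u = global_sharp f (global_sharp g u).
Proof.
have l : topO Z <=o f @^-1o (g @^-1o topO X) by [].
have k : f @^-1o (topO Y) <=o f @^-1o (g @^-1o topO X) by [].
by rewrite /= (mor_nat _ k) !(rs_res_comp _ _ l).
Qed.

(** * The Picard group *)

(** Bundling a line bundle with its local triviality makes the laws below
    unconditional, so that they can be used for rewriting modulo isomorphism. *)
Record lineb (Y : ringedSpace) := Lineb { lb :> module Y; lbP : line_bundle lb }.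

Section Pic.
Variable Y : ringedSpace.
Implicit Types L M N P : lineb Y.

Definition pic_eq L M : Prop := isomorphic (lb L) (lb M).
Definition pic1 : lineb Y := Lineb (@line_bundle_O Y).
Definition picM L M : lineb Y := Lineb (line_bundle_tensor (lbP L) (lbP M)).
Definition picV L : lineb Y := Lineb (line_bundle_dual (lbP L)).

#[global] Instance pic_eq_equiv : Equivalence pic_eq.
Proof.
split=> [L|L M|L M N]; [exact: isom_refl|exact: isom_sym|exact: isom_trans].
Qed.
#[global] Instance picM_proper :
  Proper (respectful pic_eq (respectful pic_eq pic_eq)) picM.
Proof.
move=> L L' [g ig] M M' [k ik]; exists (tensor_map g k).
by apply: tensor_map_iso => //; exact: lbP.
Qed.

Lemma pic_eq_refl L : pic_eq L L.
Proof. exact: isom_refl. Qed.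
#[local] Hint Resolve pic_eq_refl : core.

Local Infix "≈" := pic_eq (at level 70).
Local Infix "**" := picM (at level 40, left associativity).

Lemma picMC L M : L ** M ≈ M ** L.
Proof. by apply: tensor_comm; exact: lbP. Qed.
Lemma picMA L M N : L ** (M ** N) ≈ L ** M ** N.
Proof. by apply: tensor_assoc; exact: lbP. Qed.
Lemma pic1M L : pic1 ** L ≈ L.
Proof. exact: tensor_unit (lbP L). Qed.
Lemma picVM L : picV L ** L ≈ pic1.
Proof. exact: tensor_dual. Qed.
Lemma picM1 L : L ** pic1 ≈ L.
Proof. by rewrite picMC pic1M. Qed.
Lemma picMCA L M N : L ** (M ** N) ≈ M ** (L ** N).
Proof. by rewrite picMA (picMC L) -picMA. Qed.
Lemma picMACA L M N P : (L ** M) ** (N ** P) ≈ (L ** N) ** (M ** P).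
Proof. by rewrite -!picMA (picMCA M). Qed.
Lemma picMI L M N : L ** M ≈ L ** N -> M ≈ N.
Proof.
by move=> e; rewrite -(pic1M M) -(pic1M N) -(picVM L) -!picMA e.
Qed.
End Pic.

Section PicPull.
Variables (Y X : ringedSpace) (f : morphism Y X).
Definition pic_pull (L : lineb X) : lineb Y := Lineb (line_bundle_pull f (lbP L)).
#[global] Instance pic_pull_proper : Proper (respectful (@pic_eq X) (@pic_eq Y)) pic_pull.
Proof.
by move=> L M [g ig]; exists (pull_map f g); apply: pull_map_iso => //; exact: lbP.
Qed.
Lemma pic_pullM (L M : lineb X) :
  pic_eq (pic_pull (picM L M)) (picM (pic_pull L) (pic_pull M)).
Proof. by symmetry; exists (pull_tensor f L M); apply: pull_tensor_iso; exact: lbP. Qed.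
Lemma pic_pull1 : pic_eq (pic_pull (pic1 X)) (pic1 Y).
Proof. exact: pull_O. Qed.
End PicPull.

Lemma pic_pull_comp (Z Y X : ringedSpace) (g : morphism Y X) (f : morphism Z Y)
    (L : lineb X) :
  pic_eq (pic_pull f (pic_pull g L)) (pic_pull (comp_mor g f) L).
Proof. by apply: pull_comp; exact: lbP. Qed.

Local Infix "≈" := pic_eq (at level 70).
Local Infix "**" := picM (at level 40, left associativity).
#[local] Hint Resolve pic_eq_refl : core.

Section Descent.
Variables (X Y Ybar : scheme) (piY : morphism Y X) (f : morphism Ybar Y).
Let pib : morphism Ybar X := comp_mor piY f.
Hypothesis inj : pic_pull_injective pib.
Hypothesis tors : picX_no_2_torsion pib.

(** The part of the theorem that concerns isomorphism classes.  It fixes the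
    module of the alignment; what then separates the two maps is a unit. *)
Lemma pic_descent (L1 L2 K : lineb Y) (N : lineb X) (Mb : lineb Ybar) :
  L1 ≈ L2 ** (K ** K) ** pic_pull piY N ->
  Mb ** Mb ** pic_pull f L1 ≈ pic_pull f L2 ->
  exists M : lineb Y, M ** M ** L1 ≈ L2 /\ pic_pull f M ≈ Mb.
Proof.
move=> HL HM; pose Q := Mb ** pic_pull f K.
have QQN : Q ** Q ** pic_pull pib N ≈ pic1 Ybar.
  apply: (@picMI _ (pic_pull f L2)); rewrite picM1.
  transitivity (Mb ** Mb ** pic_pull f L1); last exact: HM.
  rewrite HL !pic_pullM pic_pull_comp -/pib /Q (picMACA Mb).
  by rewrite -(picMA (Mb ** Mb)) (picMCA (pic_pull f L2)) -(picMA (pic_pull f L2)).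
have QQ : eq_picX pib (Q ** Q) (pic1 Ybar).
  exists (picV N); split; first exact: lbP.
  have E : Q ** Q ≈ pic1 Ybar ** pic_pull pib (picV N).
    apply: (@picMI _ (pic_pull pib N)).
    by rewrite picMC QQN pic1M -pic_pullM picMC picVM pic_pull1.
  exact: E.
have [P [bP EP]] := tors (lbP Q) QQ.
pose P' : lineb X := Lineb bP.
have {}EP : Q ≈ pic_pull pib P'.
  by transitivity (pic1 Ybar ** pic_pull pib P'); [exact: EP | exact: pic1M].
have PPN : P' ** P' ** N ≈ pic1 X.
  apply: inj; [exact: lbP | exact: lbP|].
  have E : pic_pull pib (P' ** P' ** N) ≈ pic_pull pib (pic1 X).
    by rewrite !pic_pullM -EP QQN pic_pull1.
  exact: E.
exists (picV K ** pic_pull piY P'); split; last first.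
  rewrite pic_pullM pic_pull_comp -EP picMCA -pic_pullM picVM pic_pull1.
  exact: picM1.
rewrite HL (picMACA (picV K)).
have -> : L2 ** (K ** K) ** pic_pull piY N ≈ (K ** K) ** (L2 ** pic_pull piY N).
  by rewrite (picMC L2) picMA.
rewrite (picMACA (picV K ** picV K)) (picMACA (picV K)) !picVM pic1M pic1M.
by rewrite picMCA -!pic_pullM PPN pic_pull1 picM1.
Qed.
End Descent.

Theorem theorem4p4 (X Y Ybar : scheme)
    (piY : morphism Y X) (piYbar : morphism Ybar X) (f : morphism Ybar Y)
    (hX : admissible X) (hY : in_SX piY) (hYbar : in_SX piYbar)
    (hf : comp_mor piY f = piYbar)
    (L1 L2 : module Y) (hL1 : line_bundle L1) (hL2 : line_bundle L2)
    (Abar : prealignment (pull f L1) (pull f L2)) (hAbar : is_alignment Abar)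
    (hL : eq_picX_mod2 piY L1 L2) :
  exists A : prealignment L1 L2,
    is_alignment A /\ alignment_iso (pull_alignment f A) Abar.
Proof.
subst piYbar.
have [_ _ inj tors squares] := hYbar.
have [K [bK [N [bN HL]]]] := hL.
case: Abar hAbar => Mb phib [/= bMb iphib].
have [[M bM] [[phi iphi] [tau itau]]] : exists M : lineb Y,
    M ** M ** Lineb hL1 ≈ Lineb hL2 /\ pic_pull f M ≈ Lineb bMb.
  apply: (pic_descent inj tors (K := Lineb bK) (N := Lineb bN)); first exact: HL.
  by exists phib.
pose A0 := @Prealignment Y L1 L2 M phi.
pose alpha := al_map (pull_alignment f A0).
have bfM := line_bundle_pull f bM; have bfL := line_bundle_pull f hL1.
have bMM := line_bundle_tensor bM bM.
have bfMM := line_bundle_tensor bfM bfM.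
have ialpha : is_iso alpha.
  apply: is_iso_comp; last first.
    by apply: pull_map_iso => //; exact: line_bundle_tensor.
  apply: is_iso_comp; last exact: pull_tensor_iso.
  by apply: tensor_map_iso => //; [exact: pull_tensor_iso | exact: is_iso_id].
pose beta := hom_comp phib (tensor_map (tensor_map tau tau) (hom_id (pull f L1))).
have ibeta : is_iso beta.
  apply: is_iso_comp => //; apply: tensor_map_iso => //; last exact: is_iso_id.
  exact: tensor_map_iso.
have [u [uu Hu]] := iso_unit (line_bundle_tensor bfMM bfL) ialpha ibeta.
have [v [w [uv [w' ww'] Huvw]]] := squares u uu.
have w'u : is_unit w' by exists w; rewrite mulrC.
have uvY : is_unit (global_sharp piY v) by exact: unit_morph.
(* In [u = v w^2] the factor [v] comes from [X] and is absorbed by [phi]; [tau]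
   enters the comparison twice, so its multiple by [w'] absorbs [w^2]. *)
exists (@Prealignment Y L1 L2 M (scale_hom (global_sharp piY v) phi)); split.
  by split=> //; exact: scale_iso.
exists (scale_hom w' tau); split; first exact: scale_iso.
have E : tensor_map (tensor_map (scale_hom w' tau) (scale_hom w' tau))
      (hom_id (pull f L1)) =
    scale_hom (w' * w') (tensor_map (tensor_map tau tau) (hom_id (pull f L1))).
  rewrite tensor_map_scale // -{1}[hom_id _]scale_hom1 tensor_map_scale //.
  by rewrite mulr1.
have {}ww' : w' * w' * w ^+ 2 = 1.
  by rewrite expr2 mulrACA [w' * w]mulrC ww' mulr1.
rewrite /= pull_map_scale; last exact: line_bundle_tensor.
rewrite -global_sharp_comp comp_scalel E comp_scaler.
by rewrite -/beta Hu scale_homM Huvw mulrCA ww' mulr1.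
Qed.
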